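(* Let assumptions (a) and (b) of the context hold and let $\mathbb{M}$ be as in the context. Assume that there exists $N_0\in\mathbb{N}$ such that $$-\frac{\langle A(x)x,x\rangle}{\|x\|^2}+\tfrac12\mathrm{trace}A(x)+\langle\mathbf{G}(x),x\rangle\le0$$ for a.e. $x\in\mathbb{R}^d\setminus\overline{B}_{N_0}$. Then $\mathbb{M}$ is recurrent in the probabilistic sense. In particular, if $d=2$, $N_0\in\mathbb{N}$, $\Psi_1,\Psi_2\in C(\mathbb{R}^2)$ with $\Psi_1(x),\Psi_2(x)>0$ for all $x\in\mathbb{R}^2$, $Q=(q_{ij})_{1\le i,j\le2}$ is a matrix of measurable functions with $Q^T(x)Q(x)=\mathrm{id}$ for all $x\in\mathbb{R}^2\setminus\overline{B}_{N_0}$, $$A(x)=Q^T(x)\begin{pmatrix}\Psi_1(x)&0\\0&\Psi_2(x)\end{pmatrix}Q(x)\quad\text{for all }x\in\mathbb{R}^2\setminus\overline{B}_{N_0},$$ and $$\frac{|\Psi_1(x)-\Psi_2(x)|}2+\langle\mathbf{G}(x),x\rangle\le0$$ for a.e. $x\in\mathbb{R}^2\setminus\overline{B}_{N_0}$, then $\mathbb{M}$ is recurrent in the probabilistic sense.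
   Context: Let $d\ge2$, $p\in(d,\infty)$, $q=\frac{pd}{p+d}$. $B_r$ is the open Euclidean ball of radius $r$ about $0$. For a matrix $B=(b_{ij})$ of functions, $\nabla B$ is the vector field with $i$-th component $\sum_j\partial_jb_{ij}$. Assumption (a): $A=(a_{ij})$ with $a_{ji}=a_{ij}\in H^{1,2}_{loc}(\mathbb{R}^d)\cap C(\mathbb{R}^d)$, such that for every relatively compact $V$ there is $\nu_V>0$ with $\nu_V^{-1}\|\xi\|^2\le\langle A(x)\xi,\xi\rangle\le\nu_V\|\xi\|^2$ for all $\xi\in\mathbb{R}^d$, $x\in V$; $C=(c_{ij})$ with $-c_{ji}=c_{ij}\in H^{1,2}_{loc}(\mathbb{R}^d)\cap C(\mathbb{R}^d)$; $\mathbf{H}\in L^p_{loc}(\mathbb{R}^d,\mathbb{R}^d)$. Put $\mathbf{G}=(g_1,\dots,g_d)=\tfrac12\nabla(A+C^T)+\mathbf{H}$ and $Lf=\tfrac12\sum_{i,j}a_{ij}\partial_{ij}f+\sum_ig_i\partial_if$, $f\in C^2(\mathbb{R}^d)$. Assumption (b): $\mathbf{G}\in L^q_{loc}(\mathbb{R}^d,\mathbb{R}^d)$. Measure: $\mu=\rho\,dx$, where $\rho\in H^{1,p}_{loc}(\mathbb{R}^d)\cap C(\mathbb{R}^d)$, $\rho>0$ everywhere, and $\int Lf\,d\mu=0$ for all $f\in C_0^\infty(\mathbb{R}^d)$ (such $\rho$ exists under (a); one is fixed). Semigroup: put $\beta^{\rho,A}_i=\tfrac12\sum_j(\partial_ja_{ij}+a_{ij}\tfrac{\partial_j\rho}\rho)$,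 $\mathbf{B}=\mathbf{G}-\beta^{\rho,A}$. For relatively compact open $V$ let $(L^{0,V},D(L^{0,V}))$ be the self-adjoint generator on $L^2(V,\mu)$ of the closure of $\tfrac12\int_V\langle A\nabla u,\nabla v\rangle d\mu$, $u,v\in C_0^\infty(V)$. The operator $L^{0,V}u+\langle\mathbf{B},\nabla u\rangle$ on bounded $u\in D(L^{0,V})$ is closable in $L^1(V,\mu)$ and its closure generates a sub-Markovian $C_0$-semigroup of contractions, with resolvent $\overline{G}^V_\alpha$; put $\overline{G}^V_\alpha f:=\overline{G}^V_\alpha(f1_V)$ (zero outside $V$) for $f\in L^1(\mathbb{R}^d,\mu)$. For relatively compact open $V_n\uparrow\mathbb{R}^d$ the limits $\overline{G}_\alpha f=\lim_n\overline{G}^{V_n}_\alpha f$ exist in $L^1(\mathbb{R}^d,\mu)$, do not depend on $(V_n)$, and form the resolvent of a sub-Markovian $C_0$-semigroup of contractions $(\overline{T}_t)_{t>0}$ on $L^1(\mathbb{R}^d,\mu)$, whose generator extends $(L,C_0^\infty(\mathbb{R}^d))$. $(T_t)_{t>0}$ denotes the sub-Markovian semigroup on every $L^s(\mathbb{R}^d,\mu)$, $s\in[1,\infty]$, obtained by restricting $(\overline{T}_t)$ to $L^1\cap L^\infty$ and extending. For $f\in\bigcup_{s\in[1,\infty]}L^s(\mathbb{R}^d,\mu)$ and $t>0$, $T_tf$ has a continuous $\mu$-version, denoted $P_tf$; $P_0=\mathrm{id}$. Process: under (a) and (b), $\mathbb{M}=(\Omega,\mathcal{F},(\mathcal{F}_t)_{t\ge0},(X_t)_{t\ge0},(\mathbb{P}_x)_{x\in\mathbb{R}^d\cup\{\Delta\}})$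 is the Hunt process with state space $\mathbb{R}^d$, with continuous sample paths on the one-point compactification $\mathbb{R}^d_\Delta$ (absorbed at $\Delta$ after the lifetime $\zeta=\inf\{t\ge0:X_t=\Delta\}$), such that $P_tf(x)=\mathbb{E}_x[f(X_t)]$ for all $t\ge0$, $x\in\mathbb{R}^d$, $f$ bounded Borel, with $f(\Delta):=0$. Definition. For $E\in\mathcal{B}(\mathbb{R}^d)$ let $L_E=\sup\{t\ge0:X_t\in E\}$ ($\sup\emptyset:=0$). $\mathbb{M}$ is recurrent in the probabilistic sense if $\mathbb{P}_x(L_U=\infty)=1$ for all $x\in\mathbb{R}^d$ and all non-empty open $U\subset\mathbb{R}^d$. *)

(* Defs.v *)
From HB Require Import structures.
From mathcomp Require Import all_boot all_order all_algebra.
From mathcomp Require Import all_classical all_reals all_analysis.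
From mathcomp Require Import measurable_realfun.

Set Implicit Arguments.
Unset Strict Implicit.
Unset Printing Implicit Defensive.

Import Order.TTheory GRing.Theory Num.Theory.
Import numFieldNormedType.Exports.

Local Open Scope classical_set_scope.
Local Open Scope ring_scope.

Section borel_rV.
Variables (R : realType) (n : nat).

Let borel := <<s [set U : set 'rV[R]_n | open U] >>.

Let borel0 : borel set0. Proof. exact: sigma_algebra0. Qed.

Let borelC A : borel A -> borel (~` A). Proof. exact: sigma_algebraC. Qed.

Let borel_bigcup (F : (set 'rV[R]_n)^nat) : (forall i, borel (F i)) ->
  borel (\bigcup_i F i).
Proof. exact: sigma_algebra_bigcup. Qed.

HB.instance Definition _ :=
  @isMeasurable.Build (sigma_display [set U : set 'rV[R]_n | open U])
    'rV[R]_n borel borel0 borelC borel_bigcup.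

End borel_rV.

Lemma measurable_fun_rV (R : realType) (n : nat) (d : measure_display)
    (T : measurableType d) (f : T -> 'rV[R]_n) :
  (forall i, measurable_fun setT (fun t => f t 0 i)) -> measurable_fun setT f.
Proof.
move=> mf; apply: (measurability [set U : set 'rV[R]_n | open U]) => //.
move=> _ [U oU <-]; rewrite setTI.
pose b (c : 'rV[rat]_n * nat) :=
  ball (map_mx ratr c.1 : 'rV[R]_n) (c.2.+1%:R^-1 : R).
have -> : U = \bigcup_c (if `[< b c `<=` U >] then b c else set0).
  apply/seteqP; split => [x Ux|x [c _]]; last by case: asboolP => // /[apply].
  have /nbhs_ballP[e /= e0 xeU] : nbhs x U by exact: open_nbhs_nbhs.
  pose k := Num.trunc (e / 2)^-1.
  have k2 : k.+1%:R^-1 < e / 2 :> R.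
    by rewrite invf_plt ?posrE ?divr_gt0// truncnS_gt.
  have k0 : 0 < k.+1%:R^-1 :> R by rewrite invr_gt0.
  have qP i : {q : rat | `|x 0 i - ratr q| < k.+1%:R^-1}.
    apply: cid; have [|q] := @rat_in_itvoo R (x 0 i) (x 0 i + k.+1%:R^-1).
      by rewrite ltrDl.
    rewrite in_itv/= => /andP[xq qx]; exists q.
    by rewrite distrC gtr0_norm ?subr_gt0// ltrBlDl.
  exists (\row_i sval (qP i), k) => //.
  have qx : ball (map_mx ratr (\row_i sval (qP i)) : 'rV[R]_n) k.+1%:R^-1 x.
    split=> // i j; rewrite (ord1 i) !mxE /ball /=.
    by rewrite distrC; exact: (svalP (qP j)).
  rewrite /b /=; case: asboolP => //; apply: contra_notP => _ y qy; apply: xeU.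
  apply: (@le_ball _ _ x (k.+1%:R^-1 + k.+1%:R^-1)).
    by rewrite ltW// (splitr e) ltrD.
  exact: ball_triangle (ball_sym qx) qy.
rewrite preimage_bigcup; apply: countable_bigcupT_measurable => // c.
case: asboolP => _; last by rewrite preimage_set0.
have -> : f @^-1` b c =
    \bigcap_(i in [set: 'I_n])
      ((fun t => f t 0 i) @^-1` ball (ratr (c.1 0 i) : R) c.2.+1%:R^-1).
  apply/seteqP; split=> [t [_ h] i _|t h].
    by have := h 0 i; rewrite mxE.
  by split=> [|i j]; [rewrite invr_gt0 | rewrite (ord1 i) mxE; exact: h].
apply: fin_bigcap_measurable => // i _.
by rewrite -[X in measurable X]setTI; apply: mf => //; exact: measurable_ball.
Qed.

Definition rV_rcons (R : realType) (n : nat) (c : 'rV[R]_n * R) : 'rV[R]_n.+1 :=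
  \row_i oapp (c.1 0) c.2 (unlift ord_max i).

Lemma measurable_rV_coord (R : realType) (n : nat) (i : 'I_n) :
  measurable_fun setT (fun x : 'rV[R]_n => x 0 i).
Proof.
apply: (measurability _ (RGenOpens.measurableE R)).
move=> _ [_ [a [b ->]] <-]; rewrite setTI; apply: sub_sigma_algebra => /=.
by apply: open_comp => [x _|]; [exact: coord_continuous|exact: interval_open].
Qed.

Lemma measurable_rV_rcons (R : realType) (n : nat) :
  measurable_fun setT (@rV_rcons R n).
Proof.
apply: measurable_fun_rV => i; rewrite /rV_rcons.
case: (unliftP ord_max i) => [j ij|ij].
- rewrite (_ : (fun _ => _) = (fun x : 'rV[R]_n => x 0 j) \o fst); last first.
    by apply/funext => c /=; rewrite mxE ij liftK.
  exact: measurableT_comp (measurable_rV_coord j) measurable_fst.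
- rewrite (_ : (fun _ => _) = snd); first exact: measurable_snd.
  by apply/funext => c /=; rewrite mxE ij unlift_none.
Qed.

Section rcons_measure.
Variables (R : realType) (n : nat) (m : {measure set 'rV[R]_n -> \bar R}).

Definition rcons_measure : set 'rV[R]_n.+1 -> \bar R :=
  pushforward (m \x @lebesgue_measure R)%E (@rV_rcons R n).

Let pushforward_rcons : {measure set 'rV[R]_n.+1 -> \bar R} :=
  measure_function_pushforward__canonical__measure_function_Measure
    (m \x @lebesgue_measure R)%E (@measurable_rV_rcons R n).

HB.instance Definition _ := isMeasure.Build _ _ _ rcons_measure
  (measure0 pushforward_rcons) (measure_ge0 pushforward_rcons)
  (@measure_semi_sigma_additive _ _ _ pushforward_rcons).

End rcons_measure.

(* Lebesgue measure on R^n, as the n-fold product of the one on R. *)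
Fixpoint lebesgue_rV (R : realType) (n : nat) :
    {measure set 'rV[R]_n -> \bar R} :=
  match n with
  | 0 => dirac (0 : 'rV[R]_0)
  | n'.+1 => rcons_measure (lebesgue_rV R n')
  end.

Lemma lebesgue_rV_box (R : realType) (n : nat) (a b : 'rV[R]_n) :
  (forall i, a 0 i <= b 0 i) ->
  lebesgue_rV R n [set x | forall i, a 0 i <= x 0 i <= b 0 i] =
  (\prod_i (b 0 i - a 0 i))%:E.
Proof.
elim: n => [|n IHn] in a b * => ab.
  rewrite big_ord0 /= diracE mem_set//; by case.
pose pre (x : 'rV[R]_n.+1) : 'rV[R]_n := \row_i x 0 (lift ord_max i).
pose box := [set x : 'rV[R]_n | forall i, pre a 0 i <= x 0 i <= pre b 0 i].
have mbox : measurable box.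
  rewrite (_ : box = \bigcap_(i in [set: 'I_n])
      ((fun x : 'rV[R]_n => x 0 i) @^-1` `[pre a 0 i, pre b 0 i])); last first.
    apply/seteqP; split=> [x h i _|x h i]; first by rewrite /= in_itv; exact: h.
    by have := h i I; rewrite /= in_itv.
  apply: fin_bigcap_measurable => // i _; rewrite -[X in measurable X]setTI.
  exact: measurable_rV_coord.
transitivity ((lebesgue_rV R n \x @lebesgue_measure R)%E
    (box `*` (`[a 0 ord_max, b 0 ord_max]%classic : set R))).
  congr product_measure1; apply/seteqP; split => -[x y] /=.
    move=> h; split=> [i|].
      by have := h (lift ord_max i); rewrite !mxE liftK.
    by have := h ord_max; rewrite mxE unlift_none in_itv.
  rewrite in_itv/= => -[h1 h2] i; case: (unliftP ord_max i) => [j ->|->].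
    by rewrite mxE liftK /=; have := h1 j; rewrite !mxE.
  by rewrite mxE unlift_none.
have abE : (@lebesgue_measure R) (`[a 0 ord_max, b 0 ord_max]%classic : set R) =
    (b 0 ord_max - a 0 ord_max)%:E.
  rewrite lebesgue_measure_itv/= lte_fin; case: ltP => [//|ba].
  suff -> : b 0 ord_max = a 0 ord_max by rewrite subrr.
  by apply/eqP; rewrite eq_le ba ab.
apply: (etrans (@product_measure1E _ _ _ _ R (lebesgue_rV R n)
  (@lebesgue_measure R) _ _ mbox _)); first exact: measurable_itv.
transitivity (lebesgue_rV R n box * (b 0 ord_max - a 0 ord_max)%:E)%E.
  by congr (_ * _)%E.
rewrite IHn => [|i]; last by rewrite !mxE.
rewrite -EFinM big_ord_recr/=; congr (_ * _)%:E.
apply: eq_bigr => i _; rewrite !mxE.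
suff -> : widen_ord (leqnSn n) i = lift ord_max i by [].
by apply/val_inj; rewrite /= /bump leqNgt ltn_ord.
Qed.

Section sobolev.
Variables (R : realType) (d : nat).
Local Notation Rd := 'rV[R]_d.
Implicit Types (f g : Rd -> R) (V : set Rd).

Definition dot (u v : Rd) : R := \sum_i u 0 i * v 0 i.

(* The norm of the library on 'rV[R]_d is the sup norm. *)
Definition enorm (x : Rd) : R := Num.sqrt (dot x x).

(* The image M u of u, with coordinates \sum_j M i j * u 0 j. *)
Definition mxapp (M : 'M[R]_d) (u : Rd) : Rd := u *m M^T.

Definition pd (i : 'I_d) f : Rd -> R := fun x => 'D_(delta_mx 0 i) f x.

Definition grad f (x : Rd) : Rd := \row_i pd i f x.

Definition smooth f := forall s : seq 'I_d,
  continuous (foldr pd f s) /\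
  forall i x, derivable (foldr pd f s) x (delta_mx 0 i).

Definition test_fun V f :=
  [/\ smooth f, compact (closure [set x | f x != 0]) &
      closure [set x | f x != 0] `<=` V].

Definition Lploc V (s : \bar R) f := forall K, compact K -> K `<=` V ->
  f \* \1_K \in Lfun (lebesgue_rV R d) s.

Definition weak_pd V (i : 'I_d) f g :=
  [/\ Lploc V 1%E f, Lploc V 1%E g &
      forall phi, test_fun V phi ->
        \int[lebesgue_rV R d]_(x in V) (f x * pd i phi x) =
        - \int[lebesgue_rV R d]_(x in V) (g x * phi x)].

(* A chosen version of the weak derivative on V (unique up to a null set);
   constantly 0 if there is none. *)
Definition wpd V (i : 'I_d) f : Rd -> R := xget (cst 0) [set g | weak_pd V i f g].

Definition wgrad V f (x : Rd) : Rd := \row_i wpd V i f x.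

Definition H1loc (s : \bar R) f :=
  Lploc setT s f /\
  forall i, exists g, Lploc setT s g /\ weak_pd setT i f g.

Definition mx_div (B : Rd -> 'M[R]_d) (x : Rd) : Rd :=
  \row_i \sum_j wpd setT j (fun y => B y i j) x.

End sobolev.

Section coefficients.
Variables (R : realType) (d : nat).
Local Notation Rd := 'rV[R]_d.

Record assumption_a (p : R) (A C : Rd -> 'M[R]_d) (H : Rd -> Rd) : Prop := {
  A_sym : forall x i j, A x j i = A x i j ;
  A_H12 : forall i j, H1loc 2%:E (fun x => A x i j) ;
  A_cont : forall i j, continuous (fun x => A x i j) ;
  A_elliptic : forall V : set Rd, compact (closure V) ->
    exists2 nu : R, 0 < nu & forall x xi, V x ->
      nu^-1 * enorm xi ^+ 2 <= dot (mxapp (A x) xi) xi <= nu * enorm xi ^+ 2 ;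
  C_antisym : forall x i j, - C x j i = C x i j ;
  C_H12 : forall i j, H1loc 2%:E (fun x => C x i j) ;
  C_cont : forall i j, continuous (fun x => C x i j) ;
  H_Lp : forall i, Lploc setT p%:E (fun x => H x 0 i)
}.

Definition drift (A C : Rd -> 'M[R]_d) (H : Rd -> Rd) (x : Rd) : Rd :=
  2^-1 *: mx_div (fun y => A y + (C y)^T) x + H x.

Definition assumption_b (p : R) (G : Rd -> Rd) : Prop :=
  forall i, Lploc setT ((p * d%:R) / (p + d%:R))%:E (fun x => G x 0 i).

Definition diff_op (A : Rd -> 'M[R]_d) (G : Rd -> Rd) (f : Rd -> R) (x : Rd) : R :=
  2^-1 * (\sum_i \sum_j A x i j * pd i (pd j f) x)
  + \sum_i G x 0 i * pd i f x.

Record invariant_density (p : R) (A : Rd -> 'M[R]_d) (G : Rd -> Rd)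
    (rho : Rd -> R) (mu : {measure set Rd -> \bar R}) : Prop := {
  rho_H1p : H1loc p%:E rho ;
  rho_cont : continuous rho ;
  rho_gt0 : forall x, 0 < rho x ;
  mu_density : forall U, measurable U ->
    mu U = (\int[lebesgue_rV R d]_(x in U) (rho x)%:E)%E ;
  mu_invariant : forall f, test_fun setT f -> \int[mu]_x diff_op A G f x = 0
}.

Definition log_drift (A : Rd -> 'M[R]_d) (rho : Rd -> R) (x : Rd) : Rd :=
  \row_i (2^-1 * \sum_j (wpd setT j (fun y => A y i j) x +
                         A x i j * (wpd setT j rho x / rho x))).

End coefficients.

(* Elements of L^s are represented by functions; operators on L^s are given by their
   graphs or by maps on representatives, up to mu-a.e. equality. *)
Section semigroup.
Variables (R : realType) (d : nat).
Local Notation Rd := 'rV[R]_d.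
Variables (A : Rd -> 'M[R]_d) (G : Rd -> Rd) (rho : Rd -> R).
Variable mu : {measure set Rd -> \bar R}.
Implicit Types (f g u v w : Rd -> R) (V : set Rd) (un vn fn : nat -> Rd -> R).

Definition in_Lp V (s : \bar R) f := f \* \1_V \in Lfun mu s.

Definition dist_Lp V (s : \bar R) f g : \bar R :=
  'N[mu]_s[EFin \o ((f \- g) \* \1_V)%R]%E.

Definition cvg_Lp V (s : \bar R) fn f :=
  dist_Lp V s (fn n) f @[n --> \oo] --> 0%E.

Definition pre_form V u v : R :=
  2^-1 * \int[mu]_(x in V) dot (mxapp (A x) (grad u x)) (grad v x).

(* u belongs to the domain of the closure of pre_form on L^2(V, mu), as the
   limit of the sequence un, and the closure is the limit of pre_form along
   such sequences. *)
Definition form_approx V un u :=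
  [/\ forall n, test_fun V (un n), in_Lp V 2%:E u, cvg_Lp V 2%:E un u &
      (fun nm => pre_form V (un nm.1 \- un nm.2) (un nm.1 \- un nm.2))
        @ (\oo, \oo) --> (0 : R)].

(* w = L^{0,V} u: the form at (u, v) is - <w, v> for all v in its domain. *)
Definition sym_gen V u w :=
  [/\ exists un, form_approx V un u, in_Lp V 2%:E w &
      forall un vn v, form_approx V un u -> form_approx V vn v ->
        pre_form V (un n) (vn n) @[n --> \oo] -->
        - \int[mu]_(x in V) (w x * v x)].

(* f = L^{0,V} u + <B, grad u> for a bounded u in D(L^{0,V}). *)
Definition local_op V u f :=
  [/\ in_Lp V +oo%E u, in_Lp V 1%E f &
      exists2 w, sym_gen V u w &
        \forall x \ae mu, V x ->
          f x = w x + dot (G x - log_drift A rho x) (wgrad V u x)].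

Definition local_op_closure V u f :=
  [/\ in_Lp V 1%E u, in_Lp V 1%E f &
      exists un fn, [/\ forall n, local_op V (un n) (fn n),
                        cvg_Lp V 1%E un u & cvg_Lp V 1%E fn f]].

(* u = G^V_alpha (f 1_V), extended by 0 outside V. *)
Definition local_resolvent V (alpha : R) f u :=
  (forall x, ~ V x -> u x = 0) /\ local_op_closure V u (alpha \*o u \- f).

Definition exhaustion (Vn : nat -> set Rd) :=
  [/\ forall n, open (Vn n), forall n, compact (closure (Vn n)),
      forall n, Vn n `<=` Vn n.+1 & \bigcup_n Vn n = setT].

Definition global_resolvent (alpha : R) f u :=
  u \in Lfun mu 1%E /\
  forall Vn, exhaustion Vn ->
    exists2 un, forall n, local_resolvent (Vn n) alpha f (un n) &
                cvg_Lp setT 1%E un u.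

Record sub_markovian_C0 (T : R -> (Rd -> R) -> Rd -> R) : Prop := {
  sg_L1 : forall t f, 0 < t -> f \in Lfun mu 1%E -> T t f \in Lfun mu 1%E ;
  sg_ae : forall t f g, 0 < t -> f \in Lfun mu 1%E -> g \in Lfun mu 1%E ->
    f = g %[ae mu] -> T t f = T t g %[ae mu] ;
  sg_linear : forall t (c : R) f g, 0 < t ->
    f \in Lfun mu 1%E -> g \in Lfun mu 1%E ->
    T t (c \*o f \+ g) = c \*o T t f \+ T t g %[ae mu] ;
  sg_contraction : forall t f, 0 < t -> f \in Lfun mu 1%E ->
    ('N[mu]_1[EFin \o T t f] <= 'N[mu]_1[EFin \o f])%E ;
  sg_sub_markov : forall t f, 0 < t -> f \in Lfun mu 1%E ->
    (\forall x \ae mu, 0 <= f x <= 1) -> \forall x \ae mu, 0 <= T t f x <= 1 ;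
  sg_semigroup : forall s t f, 0 < s -> 0 < t -> f \in Lfun mu 1%E ->
    T (s + t) f = T s (T t f) %[ae mu] ;
  sg_C0 : forall f, f \in Lfun mu 1%E ->
    dist_Lp setT 1%E (T t f) f @[t --> 0^'+] --> 0%E
}.

Definition sg_generator (T : R -> (Rd -> R) -> Rd -> R) u w :=
  [/\ u \in Lfun mu 1%E, w \in Lfun mu 1%E &
      dist_Lp setT 1%E (t^-1 \*o (T t u \- u)) w @[t --> 0^'+] --> 0%E].

(* T is the semigroup on L^1(R^d, mu) with resolvent G_alpha = lim G^{V_n}_alpha,
   i.e. alpha - (generator of T) maps G_alpha f to f. *)
Record L1_semigroup (T : R -> (Rd -> R) -> Rd -> R) : Prop := {
  T_sub_markovian_C0 : sub_markovian_C0 T ;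
  T_resolvent : forall (alpha : R) f, 0 < alpha -> f \in Lfun mu 1%E ->
    exists2 u, global_resolvent alpha f u & sg_generator T u (alpha \*o u \- f) ;
  T_extends : forall f, test_fun setT f -> sg_generator T f (diff_op A G f)
}.

(* The extension of T t from the intersection of L^1 and L^oo to L^oo:
   monotone limits for nonnegative functions, then linearity. *)
Definition Loo_ext_nonneg (T : R -> (Rd -> R) -> Rd -> R) (t : R) f g :=
  exists fn,
    [/\ forall n, fn n \in Lfun mu 1%E /\ fn n \in Lfun mu +oo%E,
        \forall x \ae mu, forall n, 0 <= fn n x <= fn n.+1 x,
        \forall x \ae mu, fn n x @[n --> \oo] --> f x &
        \forall x \ae mu, T t (fn n) x @[n --> \oo] --> g x].

(* g = T_t f in L^s, for f in L^s and s in [1, +oo]. *)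
Definition Ls_semigroup (T : R -> (Rd -> R) -> Rd -> R) (s : \bar R) (t : R)
    f g :=
  g \in Lfun mu s /\
  match s with
  | r%:E => exists fn,
      [/\ forall n, fn n \in Lfun mu 1%E /\ fn n \in Lfun mu +oo%E,
          cvg_Lp setT s fn f & cvg_Lp setT s (fun n => T t (fn n)) g]
  | _ => exists g1 g2,
      [/\ Loo_ext_nonneg T t f^\+ g1, Loo_ext_nonneg T t f^\- g2 &
          g = g1 \- g2 %[ae mu]]
  end.

Record continuous_version (T P : R -> (Rd -> R) -> Rd -> R) : Prop := {
  P_continuous : forall s t f, (1%E <= s)%E -> 0 < t -> f \in Lfun mu s ->
    continuous (P t f) ;
  P_version : forall s t f, (1%E <= s)%E -> 0 < t -> f \in Lfun mu s ->
    Ls_semigroup T s t f (P t f) ;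
  P_0 : forall f, P 0 f = f
}.

End semigroup.

(* The cemetery point is None in the one-point compactification. *)
Section process.
Variables (R : realType) (d : nat).
Local Notation Rd := 'rV[R]_d.
Local Notation RdD := (one_point_compactification 'rV[R]_d).
Variables (dO : measure_display) (Omega : measurableType dO).
Variables (Ft : R -> set (set Omega)) (X : R -> Omega -> RdD).
Variable Px : RdD -> probability Omega R.

Definition borelD : set (set RdD) := <<s [set U : set RdD | open U] >>.

Definition lifetime (w : Omega) : \bar R :=
  ereal_inf [set t%:E | t in [set t | 0 <= t /\ X t w = None]].

Definition stopping_time (sigma : Omega -> \bar R) :=
  (forall w, 0 <= sigma w)%E /\
  forall t, 0 <= t -> Ft t [set w | (sigma w <= t%:E)%E].

Definition stopped_events (sigma : Omega -> \bar R) : set (set Omega) :=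
  [set Lam | measurable Lam /\
    forall t, 0 <= t -> Ft t (Lam `&` [set w | (sigma w <= t%:E)%E])].

(* Since all paths are continuous in RdD on [0, +oo[, existence of left limits
   and quasi-left-continuity are automatic. *)
Record hunt_process : Prop := {
  Ft_sigma_algebra : forall t, 0 <= t -> sigma_algebra setT (Ft t) ;
  Ft_measurable : forall t, 0 <= t -> Ft t `<=` measurable ;
  Ft_mono : forall s t, 0 <= s -> s <= t -> Ft s `<=` Ft t ;
  Ft_right_cont : forall t, 0 <= t -> Ft t = \bigcap_(s in [set s | t < s]) Ft s ;
  X_adapted : forall t B, 0 <= t -> borelD B -> Ft t (X t @^-1` B) ;
  X_shift : exists theta : R -> Omega -> Omega,
    forall s t w, 0 <= s -> 0 <= t -> X s (theta t w) = X (s + t) w ;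
  X_continuous : forall w, {within [set t : R | 0 <= t], continuous (X^~ w)} ;
  X_absorbed : forall t w, 0 <= t -> (lifetime w <= t%:E)%E -> X t w = None ;
  Px_measurable : forall Gam,
    <<s \bigcup_(t in [set t : R | 0 <= t]) [set X t @^-1` B | B in borelD] >> Gam ->
    forall Y : set (\bar R), measurable Y -> borelD ((fun x => Px x Gam) @^-1` Y) ;
  X_normal : forall x, Px x [set w | X 0 w = x] = 1%E ;
  X_strong_markov : forall sigma Lam x t B,
    stopping_time sigma -> stopped_events sigma Lam -> 0 <= t -> borelD B ->
    Px x (Lam `&` [set w | (sigma w < +oo)%E /\ B (X (fine (sigma w) + t) w)]) =
    (\int[Px x]_(w in Lam `&` [set w | (sigma w < +oo)%E])
       Px (X (fine (sigma w)) w) (X t @^-1` B))%E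
}.

Definition transition (P : R -> (Rd -> R) -> Rd -> R) :=
  forall t x (f : Rd -> R), 0 <= t -> measurable_fun setT f ->
    (exists M : R, forall y, `|f y| <= M) ->
    (P t f x)%:E = (\int[Px (Some x)]_w (oapp f 0 (X t w))%:E)%E.

(* The supremum of a set of nonnegative reals in [0, +oo], with sup set0 = 0. *)
Definition last_exit (E : set Rd) (w : Omega) : \bar R :=
  Order.max 0%E
    (ereal_sup [set t%:E | t in [set t | 0 <= t /\ (Some @` E) (X t w)]]).

Definition recurrent := forall (x : Rd) (U : set Rd), open U -> U !=set0 ->
  Px (Some x) [set w | last_exit U w = +oo%E] = 1%E.

End process.

Record diffusion_setting (R : realType) (d : nat) (p : R)
    (A C : 'rV[R]_d -> 'M[R]_d) (H : 'rV[R]_d -> 'rV[R]_d)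
    (rho : 'rV[R]_d -> R) (mu : {measure set 'rV[R]_d -> \bar R})
    (T P : R -> ('rV[R]_d -> R) -> 'rV[R]_d -> R)
    (dO : measure_display) (Omega : measurableType dO)
    (Ft : R -> set (set Omega))
    (X : R -> Omega -> one_point_compactification 'rV[R]_d)
    (Px : one_point_compactification 'rV[R]_d -> probability Omega R) : Prop := {
  ds_dim : (2 <= d)%N ;
  ds_p : d%:R < p ;
  ds_a : assumption_a p A C H ;
  ds_b : assumption_b p (drift A C H) ;
  ds_density : invariant_density p A (drift A C H) rho mu ;
  ds_semigroup : L1_semigroup A (drift A C H) rho mu T ;
  ds_version : continuous_version mu T P ;
  ds_hunt : hunt_process Ft X Px ;
  ds_transition : transition X Px P
}.

(* Main.v *)
Require Import Defs.
From mathcomp Require Import all_boot all_order all_algebra.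
From mathcomp Require Import all_classical all_reals all_analysis.
From mathcomp Require Import measurable_realfun ess_sup_inf ring lra.

(** Put s = |x|^2 and chi_n = e^2 theta((1 - m(s) / n) / 2), where
    m(s) = ln (1 + ln (1 + s)) and theta(y) = exp (-1 / y) for y > 0, theta(y) = 0
    otherwise. These test functions increase to 1, and the hypothesis together with
    the convexity of theta on ]-oo, 1/2] gives L chi_n >= 0 outside a ball, so that
    the integral of the negative part of L chi_n is O(1 / n). Since T_t is a positive
    L^1-contraction, (chi_n - T_1 chi_n)^+ tends to 0 in L^1.

    This yields P_1 1 = 1 and, by comparing the total mass of chi_n with the mass
    absorbed by a chain killed at rate proportional to P_1 w - w, a Liouville theorem:
    a bounded w with w <= P_1 w satisfies w = P_1 w a.e. Let r(x) be the probability
    that the skeleton X_1, X_2, ... avoids the open set U. The function r 1_(U^c) lies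
    below its image r under P_1, so r = 0 on U and r = P_1 r; then
    r^2 <= P_1 (r^2) forces P_1 (r^2) = r^2, so r(X_1) = r(X_0) and r takes only the
    values 0 and 1. The strong Feller property makes r continuous, and R^d is
    connected, hence r = 0: no Harnack inequality is needed for irreducibility. *)

Import Order.TTheory GRing.Theory Num.Theory.
Import numFieldNormedType.Exports.

Set Implicit Arguments.
Unset Strict Implicit.
Unset Printing Implicit Defensive.

Local Open Scope classical_set_scope.
Local Open Scope ring_scope.

(** The condition says exactly that ln |x| is a supersolution of L outside a ball. Smoothing it at
    the origin to ln (1 + s) destroys this, because s / (1 + s) increases; one more logarithm
    restores it for large s, whence the double logarithm m. The profile theta cuts m off smoothly:
    the factor 1/2 keeps its argument where theta is convex, and e^2 = 1 / theta(1/2) normalizes the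
    limit to 1.

    Inside the ball no sign is available and the drift is merely locally integrable. Its positive
    part is controlled there by one fixed L chi_N, which lies in L^1(mu) because chi_N is in the
    domain of the L^1 generator.

    L is not symmetric in general, so the classical criterion by vanishing energies is replaced by
    smallness of the positive part of chi_n - P_1 chi_n alone. One-sided smallness is enough,
    because every argument compares masses under a positive contraction; continuity of the functions
    P_1 f then turns almost everywhere identities into pointwise ones. The integer-time skeleton
    suffices: visits to U at arbitrarily late integer times already make the last exit time
    infinite, and only constant stopping times occur. *)

Section bounded_measurable.
Context {d : measure_display} {T : measurableType d} {R : realType}.
Implicit Types f g : T -> R.

(** The class on which [transition] specifies [P]. Its members are genuine functions, not classes
    modulo null sets, so operators can be iterated pointwise on it. *)
Definition bounded_mfun f := measurable_fun setT f /\ exists M, forall x, `|f x| <= M.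

Lemma bounded_mfun_cst c : bounded_mfun (fun=> c).
Proof. by split=> //; exists `|c|. Qed.

Lemma bounded_mfunD f g : bounded_mfun f -> bounded_mfun g ->
  bounded_mfun (fun x => f x + g x).
Proof.
move=> [mf [M fM]] [mg [N gN]]; split; first exact: measurable_funD.
by exists (M + N) => x; rewrite (le_trans (ler_normD _ _))// lerD.
Qed.

Lemma bounded_mfunM f g : bounded_mfun f -> bounded_mfun g ->
  bounded_mfun (fun x => f x * g x).
Proof.
move=> [mf [M fM]] [mg [N gN]]; split; first exact: measurable_funM.
by exists (M * N) => x; rewrite normrM ler_pM.
Qed.

Lemma bounded_mfunN f : bounded_mfun f -> bounded_mfun (fun x => - f x).
Proof.
by move=> [mf [M fM]]; split; [exact: measurableT_comp|exists M => x; rewrite normrN].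
Qed.

Lemma bounded_mfunB f g : bounded_mfun f -> bounded_mfun g ->
  bounded_mfun (fun x => f x - g x).
Proof. by move=> bf /bounded_mfunN; exact: bounded_mfunD. Qed.

Lemma bounded_mfunX f n : bounded_mfun f -> bounded_mfun (fun x => f x ^+ n).
Proof.
move=> bf; elim: n => [|n IH]; first exact: bounded_mfun_cst.
rewrite (_ : (fun x => _) = fun x => f x * f x ^+ n); last first.
  by apply/funext => x; rewrite exprS.
exact: bounded_mfunM.
Qed.

Lemma bounded_mfun_norm f : bounded_mfun f -> bounded_mfun (fun x => `|f x|).
Proof.
by move=> [mf [M fM]]; split; [exact: measurableT_comp|exists M => x; rewrite normr_id].
Qed.

Lemma bounded_mfun_max f g : bounded_mfun f -> bounded_mfun g ->
  bounded_mfun (fun x => Num.max (f x) (g x)).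
Proof.
move=> [mf [M fM]] [mg [N gN]]; split; first exact: measurable_maxr.
exists (M + N) => x; have := fM x; have := gN x.
rewrite !ler_norml => /andP[? ?] /andP[? ?].
by case: (leP (f x) (g x)) => ?; apply/andP; split; lra.
Qed.

Lemma bounded_mfun_indic (A : set T) : measurable A -> bounded_mfun (\1_A : T -> R).
Proof.
move=> mA; split; first exact: measurable_indic.
by exists 1 => x; rewrite indicE; case: (_ \in _); rewrite ?normr1 ?normr0.
Qed.

Lemma bounded_mfun_cvg (fn : nat -> T -> R) f :
  (forall n, bounded_mfun (fn n)) -> (forall n x, 0 <= fn n x <= 1) ->
  (forall x, fn n x @[n --> \oo] --> f x) ->
  bounded_mfun f /\ forall x, 0 <= f x <= 1.
Proof.
move=> bfn fn01 fnf.
have f01 x : 0 <= f x <= 1.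
  apply/andP; split.
    apply: (ler_cvg_to (cvg_cst 0) (fnf x)).
    by near=> n; have /andP[] := fn01 n x.
  apply: (@ler_cvg_to _ \oo _ R (fn^~ x) (cst 1) _ _ (fnf x)); first exact: cvg_cst.
  by near=> n; have /andP[] := fn01 n x.
split => //; split; last by exists 1 => x; have /andP[? ?] := f01 x; rewrite ger0_norm.
by apply: (@measurable_fun_cvg _ _ _ _ fn) => [n|x _]; [case: (bfn n)|exact: fnf].
Unshelve. all: by end_near. Qed.

End bounded_measurable.

#[local] Hint Resolve bounded_mfun_cst : core.

(** * Integrals of nonnegative bounded functions, with values in [0, +oo] *)

Section integral_of_bounded.
Context {d : measure_display} {T : measurableType d} {R : realType}.
Variable mu : {measure set T -> \bar R}.
Implicit Types f g : T -> R.

Local Notation I f := (\int[mu]_x (f x)%:E)%E.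

Lemma int_ge0 f : (forall x, 0 <= f x) -> (0 <= I f)%E.
Proof. by move=> f0; apply: integral_ge0 => x _; rewrite lee_fin. Qed.

Lemma int_le f g : bounded_mfun f -> bounded_mfun g -> (forall x, 0 <= f x) ->
  (forall x, f x <= g x) -> (I f <= I g)%E.
Proof.
move=> [mf _] [mg _] f0 fg; apply: ge0_le_integral => //.
- by move=> x _; rewrite lee_fin.
- exact/measurable_EFinP.
- exact/measurable_EFinP.
- by move=> x _; rewrite lee_fin.
Qed.

Lemma intD f g : bounded_mfun f -> bounded_mfun g -> (forall x, 0 <= f x) ->
  (forall x, 0 <= g x) -> I (fun x => f x + g x) = (I f + I g)%E.
Proof.
move=> [mf _] [mg _] f0 g0; rewrite -ge0_integralD//.
- by move=> x _; rewrite lee_fin.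
- exact/measurable_EFinP.
- by move=> x _; rewrite lee_fin.
- exact/measurable_EFinP.
Qed.

Lemma intZ c f : bounded_mfun f -> (forall x, 0 <= f x) -> 0 <= c ->
  I (fun x => c * f x) = (c%:E * I f)%E.
Proof.
move=> [mf _] f0 c0; rewrite -ge0_integralZl_EFin//.
- by move=> x _; rewrite lee_fin.
- exact/measurable_EFinP.
Qed.

Lemma int_eq0_ae f : bounded_mfun f -> (forall x, 0 <= f x) -> I f = 0%E ->
  \forall x \ae mu, f x = 0.
Proof.
move=> [mf _] f0 If0.
have := @ae_eq_integral_abs _ _ _ mu _ measurableT (EFin \o f).
case => [|h _]; first exact/measurable_EFinP.
have : ae_eq mu [set: T] (EFin \o f) (cst 0%E).
  apply: h; rewrite -[RHS]If0; apply: eq_integral => x _ /=.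
  by rewrite ger0_norm.
by apply: filterS => x /(_ Logic.I) [].
Qed.

Lemma int_sum n (F : 'I_n -> T -> R) : (forall i, bounded_mfun (F i)) ->
  (forall i x, 0 <= F i x) ->
  I (fun x => \sum_(i < n) F i x) = (\sum_(i < n) I (F i))%E.
Proof.
move=> bF F0; rewrite -ge0_integral_sum//.
- by apply: eq_integral => x _; rewrite sumEFin.
- by move=> i; apply/measurable_EFinP; case: (bF i).
- by move=> i x _; rewrite lee_fin.
Qed.

End integral_of_bounded.

Lemma bounded_mfun_sum {d : measure_display} {T : measurableType d} {R : realType}
    n (F : 'I_n -> T -> R) : (forall i, bounded_mfun (F i)) ->
  bounded_mfun (fun x => \sum_(i < n) F i x).
Proof.
elim: n F => [|n IH] F bF.
  rewrite (_ : (fun x => _) = fun=> 0); first exact: bounded_mfun_cst.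
  by apply/funext => x; rewrite big_ord0.
rewrite (_ : (fun x => _) = fun x => F ord0 x + \sum_(i < n) F (lift ord0 i) x).
  by apply: bounded_mfunD => //; exact: IH.
by apply/funext => x; rewrite big_ord_recl.
Qed.

(** Dividing by n washes out the fixed error [c]; here [b] may be infinite. *)
Lemma lee_of_averages {R : realType} (a b c : \bar R) :
  (a \is a fin_num)%E -> (0 <= b)%E -> (c \is a fin_num)%E ->
  (forall n : nat, n%:R%:E * a <= n%:R%:E * b + c)%E -> (a <= b)%E.
Proof.
case: a => [a||]// _; case: b => [b||]//; case: c => [c||]// b0 _ h; last by rewrite leey.
rewrite lee_fin leNgt; apply/negP => ba.
pose n := (Num.truncn (c / (a - b))).+1.
have := h n; rewrite -!EFinM -EFinD lee_fin => nab.
have : c / (a - b) < n%:R by rewrite truncnS_gt.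
rewrite ltr_pdivrMr ?subr_gt0//; lra.
Qed.

(** * Sub-Markovian operators and plateau sequences *)

Section markov_operator.
Context {d : measure_display} {T : measurableType d} {R : realType}.
Variable mu : {measure set T -> \bar R}.
Implicit Types f g : T -> R.

Local Notation I f := (\int[mu]_x (f x)%:E)%E.

(** [smo_cvg] is bounded convergence, available because the intended [P] comes from a kernel.
    [smo_contraction] compares integrals in [0, +oo], so it can be applied before integrability is
    known. *)
Record sub_markov_operator (P : (T -> R) -> T -> R) : Prop := {
  smo_bounded : forall f, bounded_mfun f -> bounded_mfun (P f) ;
  smo_linear : forall c f g x, bounded_mfun f -> bounded_mfun g ->
    P (fun y => c * f y + g y) x = c * P f x + P g x ;
  smo_ge0 : forall f x, bounded_mfun f -> (forall y, 0 <= f y) -> 0 <= P f x ;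
  smo_le1 : forall x, P (fun=> 1) x <= 1 ;
  smo_cvg : forall (fn : nat -> T -> R) f x,
    (forall n, bounded_mfun (fn n)) -> (forall n y, 0 <= fn n y <= 1) ->
    (forall y, fn n y @[n --> \oo] --> f y) ->
    P (fn n) x @[n --> \oo] --> P f x ;
  smo_contraction : forall f, bounded_mfun f -> (forall y, 0 <= f y) ->
    (I (P f) <= I f)%E
}.

Variable P : (T -> R) -> T -> R.
Hypothesis HP : sub_markov_operator P.

Let Pb f : bounded_mfun f -> bounded_mfun (P f) := @smo_bounded P HP f.

Lemma smo0 x : P (fun=> 0) x = 0.
Proof.
have := smo_linear HP (-1) x (bounded_mfun_cst 0) (bounded_mfun_cst 0).
by rewrite mulr0 addr0 mulN1r addNr.
Qed.

Lemma smoD f g x : bounded_mfun f -> bounded_mfun g ->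
  P (fun y => f y + g y) x = P f x + P g x.
Proof.
move=> bf bg; have := smo_linear HP 1 x bf bg; rewrite mul1r => <-.
by congr P; apply/funext => y; rewrite mul1r.
Qed.

Lemma smoZ c f x : bounded_mfun f -> P (fun y => c * f y) x = c * P f x.
Proof.
move=> bf; have := smo_linear HP c x bf (bounded_mfun_cst 0).
rewrite smo0 addr0 => <-.
by congr P; apply/funext => y; rewrite addr0.
Qed.

Lemma smoB f g x : bounded_mfun f -> bounded_mfun g ->
  P (fun y => f y - g y) x = P f x - P g x.
Proof.
move=> bf bg; rewrite -mulN1r -smoZ// -smoD//.
  by congr P; apply/funext => y; rewrite mulN1r.
by apply: bounded_mfunM.
Qed.

Lemma smo_le f g x : bounded_mfun f -> bounded_mfun g ->
  (forall y, f y <= g y) -> P f x <= P g x.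
Proof.
move=> bf bg fg; rewrite -subr_ge0 -smoB//; apply: smo_ge0 => //.
  exact: bounded_mfunB.
by move=> y; rewrite subr_ge0.
Qed.

Lemma smo_01 f x : bounded_mfun f -> (forall y, 0 <= f y <= 1) -> 0 <= P f x <= 1.
Proof.
move=> bf f01; apply/andP; split.
  by apply: smo_ge0 => // y; have /andP[] := f01 y.
apply: le_trans (smo_le1 HP x); apply: smo_le => // y.
by have /andP[] := f01 y.
Qed.

(** * Killed operators and the mass they absorb *)

Section killing.
Variable phi : T -> R.
Hypothesis bphi : bounded_mfun phi.
Hypothesis phi01 : forall x, 0 <= phi x <= 1.

(** The chain moves first and is then killed at its new state y with probability [phi y]; its
    starting point is never tested. *)
Definition killed f : T -> R := P (fun y => (1 - phi y) * f y).

Let bker f : bounded_mfun f -> bounded_mfun (fun y => (1 - phi y) * f y).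
Proof. by move=> bf; apply: bounded_mfunM => //; exact: bounded_mfunB. Qed.

Lemma killed_bounded f : bounded_mfun f -> bounded_mfun (killed f).
Proof. by move=> bf; apply: Pb; exact: bker. Qed.

Lemma iter_killed_bounded f n : bounded_mfun f -> bounded_mfun (iter n killed f).
Proof. by move=> bf; elim: n => //= n; exact: killed_bounded. Qed.

Lemma killed_ge0 f x : bounded_mfun f -> (forall y, 0 <= f y) -> 0 <= killed f x.
Proof.
move=> bf f0; apply: (smo_ge0 HP); first exact: bker.
by move=> y; rewrite mulr_ge0// subr_ge0; have /andP[] := phi01 y.
Qed.

Lemma iter_killed_ge0 f n x : bounded_mfun f -> (forall y, 0 <= f y) ->
  0 <= iter n killed f x.
Proof.
move=> bf f0; elim: n x => //= n IH x; apply: killed_ge0 => //.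
exact: iter_killed_bounded.
Qed.

Lemma killed_le f g x : bounded_mfun f -> bounded_mfun g ->
  (forall y, f y <= g y) -> killed f x <= killed g x.
Proof.
move=> bf bg fg; apply: smo_le; [exact: bker|exact: bker|move=> y].
by rewrite ler_wpM2l// subr_ge0; have /andP[] := phi01 y.
Qed.

Lemma iter_killed_le f g n x : bounded_mfun f -> bounded_mfun g ->
  (forall y, f y <= g y) -> iter n killed f x <= iter n killed g x.
Proof.
move=> bf bg fg; elim: n x => //= n IH x.
by apply: killed_le => //; exact: iter_killed_bounded.
Qed.

Lemma killedD f g x : bounded_mfun f -> bounded_mfun g ->
  killed (fun y => f y + g y) x = killed f x + killed g x.
Proof.
move=> bf bg; rewrite /killed -smoD; [|exact: bker|exact: bker].
by congr P; apply/funext => y; rewrite mulrDr.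
Qed.

Lemma iter_killedD f g n x : bounded_mfun f -> bounded_mfun g ->
  iter n killed (fun y => f y + g y) x = iter n killed f x + iter n killed g x.
Proof.
move=> bf bg; elim: n x => //= n IH x.
rewrite -killedD; [|exact: iter_killed_bounded|exact: iter_killed_bounded].
by congr killed; apply/funext => y; exact: IH.
Qed.

(* Contractivity of [P] applied to [(1 - phi) f]: the mass killed in the first
   [n] steps is at most the initial mass. *)
Lemma killed_mass f n : bounded_mfun f -> (forall x, 0 <= f x) ->
  (\sum_(j < n) I (fun x => phi x * iter j killed f x) <= I f)%E.
Proof.
elim: n f => [|n IH] f bf f0; first by rewrite big_ord0 int_ge0.
rewrite big_ord_recl /=.
rewrite (eq_bigr (fun j : 'I_n => I (fun x => phi x * iter j killed (killed f) x))); last first.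
  by move=> j _; apply: eq_integral => x _; rewrite -iterSr.
have phi0 x : 0 <= phi x by have /andP[] := phi01 x.
have phi1 x : 0 <= 1 - phi x by have /andP[_] := phi01 x; rewrite subr_ge0.
have -> : I f = (I (fun x => phi x * f x) + I (fun x => (1 - phi x) * f x))%E.
  rewrite -intD.
  - by apply: eq_integral => x _; congr EFin; ring.
  - exact: bounded_mfunM.
  - exact: bker.
  - by move=> x; rewrite mulr_ge0.
  - by move=> x; rewrite mulr_ge0.
rewrite leeD2l//; apply: (@le_trans _ _ (I (killed f))).
  by apply: IH => [|x]; [exact: killed_bounded|exact: killed_ge0].
apply: (smo_contraction HP); first exact: bker.
by move=> x; rewrite mulr_ge0.
Qed.

End killing.

(** A substitute, valid without symmetry, for the Dirichlet form criterion of recurrence, where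
    functions tending to 1 have vanishing energy: only what [P] takes away from [chi n] has to be
    small. *)
Record plateau (chi : nat -> T -> R) : Prop := {
  pl_bounded : forall n, bounded_mfun (chi n) ;
  pl_01 : forall n x, 0 <= chi n x <= 1 ;
  pl_cvg : forall x, chi n x @[n --> \oo] --> (1 : R) ;
  pl_fin : forall n, (I (chi n) < +oo)%E ;
  pl_defect :
    I (fun x => Num.max (chi n x - P (chi n) x) 0) @[n --> \oo] --> 0%E
}.

Variable chi : nat -> T -> R.
Hypothesis Hchi : plateau chi.

Let bchi n : bounded_mfun (chi n) := pl_bounded Hchi n.
Let chi0 n x : 0 <= chi n x. Proof. by have /andP[] := pl_01 Hchi n x. Qed.
Let chi1 n x : chi n x <= 1. Proof. by have /andP[] := pl_01 Hchi n x. Qed.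
Let delta n x := Num.max (chi n x - P (chi n) x) 0.
Let bdelta n : bounded_mfun (delta n).
Proof. by apply: bounded_mfun_max => //; apply: bounded_mfunB => //; exact: Pb. Qed.
Let delta0 n x : 0 <= delta n x. Proof. by rewrite le_max lexx orbT. Qed.
Let delta_ge n x : chi n x <= P (chi n) x + delta n x.
Proof. by rewrite -lerBlDl le_max lexx. Qed.
Let bcochi n : bounded_mfun (fun x => 1 - chi n x).
Proof. exact: bounded_mfunB. Qed.
Let cochi0 n x : 0 <= 1 - chi n x. Proof. by rewrite subr_ge0. Qed.

Lemma plateau_cut phi : bounded_mfun phi -> (forall x, 0 <= phi x) ->
  (I phi < +oo)%E -> I (fun x => phi x * (1 - chi n x)) @[n --> \oo] --> 0%E.
Proof.
move=> bphi phi0 Iphi.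
have -> : 0%E = I (fun=> 0 : R) :> \bar R by rewrite integral0.
apply: (@dominated_cvg _ _ _ mu setT measurableT
  (fun n x => (phi x * (1 - chi n x))%:E) (fun=> 0%E) (EFin \o phi)) => //.
- by move=> n; apply/measurable_EFinP; apply: (bounded_mfunM bphi (bcochi n)).1.
- move=> x _; apply: cvg_EFin; first by near=> n.
  rewrite [X in _ --> X](_ : 0 = phi x * (1 - 1)); last by rewrite subrr mulr0.
  apply: cvgM; first exact: cvg_cst.
  by apply: cvgB; [exact: cvg_cst|exact: (pl_cvg Hchi)].
- apply/integrableP; split; first by apply/measurable_EFinP; case: bphi.
  rewrite (_ : (\int[mu]_x _)%E = I phi)//; apply: eq_integral => x _.
  by rewrite /= ger0_norm.
- move=> n x _; rewrite /= lee_fin ger0_norm ?mulr_ge0//.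
  by rewrite ler_piMr// lerBlDl lerDr.
Unshelve. all: by end_near. Qed.

(** As [mu] may be infinite, integrals are localized by the weights [chi n]. Nothing is lost, since
    [chi n x] is eventually positive at each x. *)
Lemma plateau_ae0 g : bounded_mfun g -> (forall x, 0 <= g x) ->
  (forall n, I (fun x => chi n x * g x) = 0%E) -> \forall x \ae mu, g x = 0.
Proof.
move=> bg g0 Ig.
have : \forall x \ae mu, forall n, chi n x * g x = 0.
  apply: ae_foralln => n; apply: int_eq0_ae => //; first exact: bounded_mfunM.
  by move=> x; rewrite mulr_ge0.
apply: filterS => x chig.
have : \forall n \near \oo, 0 < chi n x.
  exact: (@cvgr_gt _ _ _ _ _ _ (pl_cvg Hchi x)).
move=> [n _ /(_ n (leqnn n)) /= chin].
have /eqP := chig n; rewrite mulf_eq0 (gt_eqF chin) /= => /eqP. exact.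
Qed.

Lemma plateau_mul_fin n g : bounded_mfun g -> (forall x, 0 <= g x <= 1) ->
  (I (fun x => chi n x * g x) < +oo)%E.
Proof.
move=> bg g01; apply: le_lt_trans (pl_fin Hchi n).
apply: int_le => // [|x|x]; first exact: bounded_mfunM.
  by have /andP[? ?] := g01 x; rewrite mulr_ge0.
by have /andP[? ?] := g01 x; rewrite ler_piMr.
Qed.

(** From [chi n <= P (chi n) + delta n <= P 1 + delta n], the defect [1 - P 1] is at most
    [(1 - chi n) + delta n]. Integrated against a fixed [chi N], both terms tend to 0. *)
Lemma conservative_ae : \forall x \ae mu, P (fun=> 1) x = 1.
Proof.
have b1 : bounded_mfun (P (fun=> 1)) by exact: Pb.
pose g x := 1 - P (fun=> 1) x.
have bg : bounded_mfun g by exact: bounded_mfunB.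
have P1 x : 0 <= P (fun=> 1) x by apply: (smo_ge0 HP).
have g0 x : 0 <= g x by rewrite subr_ge0; exact: (smo_le1 HP).
have g1 x : g x <= 1 by rewrite lerBlDl lerDr.
suff : \forall x \ae mu, g x = 0.
  by apply: filterS => x /eqP; rewrite subr_eq0 eq_sym => /eqP.
apply: plateau_ae0 => // N.
have bg2 : bounded_mfun (fun x => chi N x * g x) by exact: bounded_mfunM.
apply/eqP; rewrite eq_le int_ge0 ?andbT; last by move=> x; rewrite mulr_ge0.
have cv : (I (fun x => chi N x * (1 - chi n x)) + I (delta n))%E @[n --> \oo] --> 0%E.
  rewrite -[X in _ --> X]adde0; apply: cvgeD => //; last exact: pl_defect.
  by apply: plateau_cut => //; exact: (pl_fin Hchi).
apply: (lee_cvg_to (cvg_cst _) cv); near=> n => /=.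
have b3 : bounded_mfun (fun x => chi N x * (1 - chi n x)) by exact: bounded_mfunM.
rewrite -intD//; last by move=> x; rewrite mulr_ge0.
apply: int_le => //; first exact: bounded_mfunD.
  by move=> x; rewrite mulr_ge0.
move=> x; have := delta_ge n x.
have : P (chi n) x <= P (fun=> 1) x by apply: smo_le.
move=> h1 h2.
have h3 : g x <= (1 - chi n x) + delta n x by rewrite /g; lra.
apply: (le_trans (ler_wpM2l (chi0 N x) h3)).
by rewrite mulrDr lerD2l ler_piMl.
Unshelve. all: by end_near. Qed.

(** The excess [P w - w] drives a killing rate [phi]. Boundedness of [w] keeps the survival
    probability above 1/2 forever, so up to small errors each step absorbs from [chi n] a mass of at
    least half the integral of [phi]; yet the total absorbed mass is at most the finite integral of
    [chi n]. Hence [phi] has integral 0. *)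
Lemma subinvariant_ae w : (forall x, P (fun=> 1) x = 1) -> bounded_mfun w ->
  (forall x, 0 <= w x <= 1) -> (forall x, w x <= P w x) ->
  \forall x \ae mu, P w x = w x.
Proof.
move=> P1 bw w01 wPw.
pose k x := P w x - w x.
have bPw : bounded_mfun (P w) by exact: Pb.
have bk : bounded_mfun k by exact: bounded_mfunB.
have Pw01 x : 0 <= P w x <= 1 by exact: smo_01.
have k0 x : 0 <= k x by rewrite subr_ge0.
have k1 x : k x <= 1.
  by rewrite /k; have /andP[? ?] := w01 x; have /andP[? ?] := Pw01 x; lra.
suff : \forall x \ae mu, k x = 0.
  by apply: filterS => x /eqP; rewrite subr_eq0 => /eqP.
apply: plateau_ae0 => // N.
(* The factor [chi N] makes [phi] integrable, and 1/2 leaves room for the barrier [v] below. *)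
pose phi x := 2^-1 * (chi N x * k x).
have bck : bounded_mfun (fun x => chi N x * k x) by exact: bounded_mfunM.
have ck0 x : 0 <= chi N x * k x by rewrite mulr_ge0.
have bphi : bounded_mfun phi by apply: bounded_mfunM.
have phi0 x : 0 <= phi x by rewrite mulr_ge0.
have phik x : phi x <= 2^-1 * k x by rewrite ler_pM2l// ler_piMl.
have phi01 x : 0 <= phi x <= 1.
  by rewrite phi0/=; have := phik x; have := k1 x; lra.
have phifin : (I phi < +oo)%E.
  rewrite intZ// lte_mul_pinfty ?lee_fin// plateau_mul_fin// => x.
  by rewrite k0 k1.
pose K := killed phi.
have half_le J x : 2^-1 <= iter J K (fun=> 1) x.
  (* [v] lies between 1/2 and 1, and [(1 - phi) v >= v - phi >= 1/2 + w/2], whose image under [P] is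
     [v]. So [v <= K v], and iteration bounds the survival probability from below. *)
  pose v x := 2^-1 + 2^-1 * P w x.
  have bv : bounded_mfun v by apply: bounded_mfunD => //; exact: bounded_mfunM.
  have bhw : bounded_mfun (fun y => 2^-1 * w y) by exact: bounded_mfunM.
  have v1 y : v y <= 1 by rewrite /v; have /andP[? ?] := Pw01 y; lra.
  have vK y : v y <= K v y.
    have -> : v y = P (fun y => 2^-1 + 2^-1 * w y) y.
      rewrite smoD// smoZ//; congr (_ + _).
      rewrite -[LHS]mulr1 -(P1 y) -smoZ//; congr P; apply/funext => z.
      by rewrite mulr1.
    apply: smo_le => [||z].
    + exact: bounded_mfunD.
    + by apply: bounded_mfunM => //; exact: bounded_mfunB.
    + have : phi z * v z <= phi z by rewrite ler_piMr.
      have := phik z; rewrite /v /k mulrBl mul1r; lra.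
  have vKJ y : v y <= iter J K v y.
    elim: J y => //= J IH y; apply: (le_trans (vK y)).
    by apply: killed_le => //; exact: iter_killed_bounded.
  apply: (@le_trans _ _ (v x)); first by rewrite /v; have /andP[? ?] := Pw01 x; lra.
  by apply: (le_trans (vKJ x)); exact: iter_killed_le.
(* Split 1 into [1 - chi n] and [chi n]. One killed step sends [1 - chi n] below [P (1 - chi n) = 1
   - P (chi n) <= (1 - chi n) + delta n], so J steps accumulate the errors [iter j K (delta n)]. *)
have le_step n J x : 2^-1 <=
    (1 - chi n x) + \sum_(j < J) iter j K (delta n) x + iter J K (chi n) x.
  apply: (le_trans (half_le J x)).
  rewrite (_ : iter J K (fun=> 1) x =
      iter J K (fun y => 1 - chi n y) x + iter J K (chi n) x); last first.
    rewrite -iter_killedD//; congr (iter J K _ x); apply/funext => y.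
    by rewrite subrK.
  rewrite lerD2r; elim: J x => [|J IH] x; first by rewrite big_ord0 addr0.
  rewrite iterSr big_ord_recr /= addrA.
  apply: (@le_trans _ _ (iter J K (fun y => (1 - chi n y) + delta n y) x)).
    apply: iter_killed_le => //; first exact: killed_bounded.
      exact: bounded_mfunD.
    move=> y; apply: (@le_trans _ _ (P (fun z => 1 - chi n z) y)).
      apply: smo_le => // [|z].
        by apply: bounded_mfunM => //; exact: bounded_mfunB.
      by rewrite ler_piMl// lerBlDl lerDr.
    by rewrite smoB// P1; have := delta_ge n y; lra.
  by rewrite iter_killedD// lerD2r.
have bKd n j : bounded_mfun (fun x => phi x * iter j K (delta n) x).
  by apply: bounded_mfunM => //; exact: iter_killed_bounded.
have Kd0 n j x : 0 <= phi x * iter j K (delta n) x.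
  by rewrite mulr_ge0//; apply: iter_killed_ge0.
have bKc n j : bounded_mfun (fun x => phi x * iter j K (chi n) x).
  by apply: bounded_mfunM => //; exact: iter_killed_bounded.
have Kc0 n j x : 0 <= phi x * iter j K (chi n) x.
  by rewrite mulr_ge0//; apply: iter_killed_ge0.
have bpc n : bounded_mfun (fun x => phi x * (1 - chi n x)) by exact: bounded_mfunM.
have pc0 n x : 0 <= phi x * (1 - chi n x) by rewrite mulr_ge0.
(* Against the weight [phi], [killed_mass] bounds all accumulated errors by the integral of
   [delta n], uniformly in J. *)
have int_step n J : (2^-1%:E * I phi <= (I (fun x => phi x * (1 - chi n x)) +
    I (delta n)) + I (fun x => (phi x * iter J K (chi n) x)%R))%E.
  apply: (@le_trans _ _ (I (fun x => phi x * (1 - chi n x)) +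
    \sum_(j < J) I (fun x => (phi x * iter j K (delta n) x)%R) +
    I (fun x => (phi x * iter J K (chi n) x)%R))%E); last first.
    by rewrite leeD2r// leeD2l//; exact: killed_mass.
  have bs : bounded_mfun (fun x => \sum_(j < J) phi x * iter j K (delta n) x).
    exact: bounded_mfun_sum.
  have s0 x : 0 <= \sum_(j < J) phi x * iter j K (delta n) x by exact: sumr_ge0.
  rewrite -int_sum// -intD// -intD//; [|exact: bounded_mfunD|by move=> x; rewrite addr_ge0].
  rewrite -intZ//; apply: int_le => //.
  - exact: bounded_mfunM.
  - by do 2 apply: bounded_mfunD => //.
  - by move=> x; rewrite mulr_ge0.
  - by move=> x; rewrite -mulr_sumr -!mulrDr mulrC ler_wpM2l.
(* [killed_mass] again, now for [chi n]: summed over J < M, the last terms stay below the integral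
   of [chi n], whatever M is. *)
have avg n : (2^-1%:E * I phi <= I (fun x => phi x * (1 - chi n x)) + I (delta n))%E.
  apply: (@lee_of_averages _ _ _ (I (chi n))).
  - by rewrite fin_numM// ge0_fin_numE// int_ge0.
  - by rewrite adde_ge0// int_ge0.
  - by rewrite ge0_fin_numE ?(pl_fin Hchi)// int_ge0.
  move=> M.
  apply: (@le_trans _ _ (M%:R%:E * (I (fun x => phi x * (1 - chi n x)) + I (delta n))
    + \sum_(J < M) I (fun x => (phi x * iter J K (chi n) x)%R))%E); last first.
    by rewrite leeD2l//; exact: killed_mass.
  elim: M => [|M IH]; first by rewrite !mul0e big_ord0 adde0.
  rewrite big_ord_recr/= -natr1 EFinD !ge0_muleDl ?lee_fin//; last 1 first.
  rewrite !mul1e addeACA leeD//.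
have cv : (I (fun x => phi x * (1 - chi n x)) + I (delta n))%E @[n --> \oo] --> 0%E.
  rewrite -[X in _ --> X]adde0; apply: cvgeD => //; last exact: pl_defect.
  exact: plateau_cut.
have : (2^-1%:E * I phi <= 0)%E.
  by apply: (lee_cvg_to (cvg_cst _) cv); near=> n; exact: avg.
rewrite /phi intZ// muleA -EFinM => h.
apply/eqP; rewrite eq_le int_ge0 ?andbT//.
by move: h; rewrite pmule_rle0// lte_fin mulr_gt0.
Unshelve. all: by end_near. Qed.

End markov_operator.

(** * Strong Feller operators *)

Section strong_feller.
Context {R : realType} {d : nat}.
Local Notation Rd := 'rV[R]_d.

Lemma open_measurable_rV (U : set Rd) : open U -> measurable U.
Proof. by move=> oU; exact: sub_sigma_algebra. Qed.

Lemma continuous_measurable_rV (f : Rd -> R) : continuous f -> measurable_fun setT f.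
Proof.
move=> cf; apply: (measurability _ (RGenOpens.measurableE R)).
move=> _ [_ [a [b ->]] <-]; rewrite setTI; apply: open_measurable_rV.
by apply: open_comp => [x _|]; [exact: cf|exact: interval_open].
Qed.

Lemma continuous_zero_one_cst (f : Rd -> R) : continuous f ->
  (forall x, f x = 0 \/ f x = 1) -> forall x y, f x = f y.
Proof.
move=> cf f01 x y.
wlog [fx fy] : x y / f x = 0 /\ f y = 1.
  move=> h; case: (f01 x) (f01 y) => fx [] fy; rewrite ?fx ?fy//.
    by have := h x y (conj fx fy); rewrite fx fy.
  by have := h y x (conj fy fx); rewrite fx fy.
pose g (t : R) := f (x + t *: (y - x)).
have cg : continuous g.
  move=> t; apply: (@continuous_comp _ _ _ (fun t : R => x + t *: (y - x)) f); last exact: cf.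
  apply: cvgD; first exact: cvg_cst.
  by apply: cvgZr_tmp; exact: cvg_id.
have g0 : g 0 = 0 by rewrite /g scale0r addr0.
have g1 : g 1 = 1 by rewrite /g scale1r addrC subrK.
have [||t _ gt] := @IVT R g 0 1 2^-1 ler01.
- exact: continuous_subspaceT.
- by rewrite g0 g1 minElt maxElt ltr01 invr_ge0 ler0n/= invf_le1// ler1n.
case: (f01 (x + t *: (y - x))); rewrite -/(g t) gt => /eqP.
  by rewrite invr_eq0 pnatr_eq0.
by rewrite invr_eq1 (eqr_nat R 2 1).
Qed.

Variable mu : {measure set Rd -> \bar R}.
Hypothesis mu_open : forall U : set Rd, open U -> U !=set0 -> mu U != 0%E.

Lemma continuous_ae_eq (f g : Rd -> R) : continuous f -> continuous g ->
  (\forall x \ae mu, f x = g x) -> forall x, f x = g x.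
Proof.
move=> cf cg [N [mN N0 fgN]] x; apply/eqP/negP => /negP fgx.
pose U := [set y | f y - g y != 0].
have oU : open U.
  have -> : U = (fun y => f y - g y) @^-1` (~` [set 0]).
    by apply/seteqP; split=> y /= /eqP.
  apply: open_comp => [y _|]; first exact: (continuousB (cf y) (cg y)).
  by apply: closed_openC; exact: closed_eq.
have U0 : U !=set0 by exists x; rewrite /U/= subr_eq0.
have /negP := mu_open oU U0; apply; apply/eqP.
apply: (subset_measure0 (open_measurable_rV oU) mN) => // y.
by rewrite /U/= subr_eq0 => /eqP fgy; exact: fgN.
Qed.

Variable P : (Rd -> R) -> Rd -> R.
Hypothesis HP : sub_markov_operator mu P.
Hypothesis P_feller : forall f, bounded_mfun f -> continuous (P f).
Variable chi : nat -> Rd -> R.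
Hypothesis Hchi : plateau mu P chi.

Lemma conservative x : P (fun=> 1) x = 1.
Proof.
apply: (@continuous_ae_eq _ (fun=> 1)).
- exact: P_feller.
- exact: cst_continuous.
- exact: (conservative_ae HP Hchi).
Qed.

Lemma subinvariant_invariant (w : Rd -> R) : continuous w ->
  bounded_mfun w -> (forall x, 0 <= w x <= 1) -> (forall x, w x <= P w x) ->
  forall x, P w x = w x.
Proof.
move=> cw bw w01 wPw; apply: continuous_ae_eq => //; first exact: P_feller.
exact: (subinvariant_ae HP Hchi conservative).
Qed.

(** * The probability of avoiding an open set *)

Section avoidance.
Variable U : set Rd.
Hypotheses (oU : open U) (U0 : U !=set0).

Let phi : Rd -> R := \1_U.
Let bphi : bounded_mfun phi.
Proof. exact: bounded_mfun_indic (open_measurable_rV oU). Qed.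
Let phi01 x : 0 <= phi x <= 1.
Proof. by rewrite /phi indicE; case: (_ \in _); rewrite ?lexx ?ler01. Qed.
Let bcophi f : bounded_mfun f -> bounded_mfun (fun y => (1 - phi y) * f y).
Proof. by move=> bf; apply: bounded_mfunM => //; exact: bounded_mfunB. Qed.

Let cophi01 a y : 0 <= a <= 1 -> 0 <= (1 - phi y) * a <= 1.
Proof. by move=> /andP[? ?]; have /andP[? ?] := phi01 y; apply/andP; split; nra. Qed.

(* The probability that the chain avoids U at the times 1, ..., n. *)
Definition avoid n : Rd -> R := iter n (killed P \1_U) (fun=> 1).

Lemma avoid_bounded n : bounded_mfun (avoid n).
Proof. exact: (iter_killed_bounded HP). Qed.

Lemma avoid01 n x : 0 <= avoid n x <= 1.
Proof.
elim: n x => [|n IH] x; first by rewrite /avoid /= lexx ler01.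
apply: (smo_01 HP) => [|y]; first exact/bcophi/avoid_bounded.
by apply: cophi01; exact: IH.
Qed.

Lemma avoid_nonincreasing x : nonincreasing_seq (avoid^~ x).
Proof.
apply/nonincreasing_seqP => n; rewrite /avoid iterSr.
apply: (iter_killed_le HP) => // [|y]; first exact: (killed_bounded HP).
by have /andP[] := avoid01 1 y.
Qed.

Lemma avoid_cvg0 x : avoid n x @[n --> \oo] --> 0.
Proof.
pose r y := limn (avoid^~ y).
have cr y : avoid n y @[n --> \oo] --> r y.
  apply: nonincreasing_is_cvgn; first exact: avoid_nonincreasing.
  by exists 0 => _ [n _ <-]; have /andP[] := avoid01 n y.
have [br r01] := bounded_mfun_cvg avoid_bounded avoid01 cr.
have r0 y : 0 <= r y by have /andP[] := r01 y.
have r1 y : r y <= 1 by have /andP[] := r01 y.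
pose f y := (1 - phi y) * r y.
have bf : bounded_mfun f by exact: bcophi.
(* The limit of the recursion [avoid n.+1 = killed P phi (avoid n)]. *)
have Pf y : P f y = r y.
  have h : P (fun z => (1 - phi z) * avoid n z) y @[n --> \oo] --> P f y.
    apply: (smo_cvg HP).
    - by move=> n; apply: bcophi; exact: avoid_bounded.
    - by move=> n z; apply: cophi01; exact: avoid01.
    - by move=> z; apply: cvgM; [exact: cvg_cst|exact: cr].
  apply: (cvg_unique _ h) => //.
  by have := cr y; rewrite -(cvg_shiftS (avoid^~ y)).
have fr y : f y <= r y.
  by have /andP[? ?] := phi01 y; rewrite ler_piMl// lerBlDl lerDr.
have cont_r : continuous r.
  by rewrite (_ : r = P f); [exact: P_feller|apply/funext].
have f01 y : 0 <= f y <= 1.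
  have /andP[? ?] := phi01 y; rewrite mulr_ge0 ?subr_ge0//=.
  exact: le_trans (fr y) (r1 y).
(* Since [f <= r = P f], the Liouville theorem gives [f = r] almost everywhere, while [f] is 0 on U.
   A point of U with [r] nonzero would have a whole neighbourhood of such points, of positive
   measure. *)
have rU y : U y -> r y = 0.
  have fae : \forall z \ae mu, P f z = f z.
    by apply: (subinvariant_ae HP Hchi conservative) => // z; rewrite Pf.
  move=> Uy; apply/eqP/negP => /negP ry.
  pose V := U `&` [set z | r z != 0].
  have oV : open V.
    apply: openI => //.
    have -> : [set z | r z != 0] = r @^-1` (~` [set 0]).
      by apply/seteqP; split=> z /= /eqP.
    apply: open_comp => [z _|]; first exact: cont_r.
    by apply: closed_openC; exact: closed_eq.
  have V0 : V !=set0 by exists y.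
  have /negP := mu_open oV V0; apply; apply/eqP.
  case: fae => N [mN N0 fN].
  apply: (subset_measure0 (open_measurable_rV oV) mN) => // z [Uz /= rz].
  apply: fN => /=; rewrite Pf /f /phi indicE mem_set// subrr mul0r.
  exact/eqP.
have fE : f = r.
  apply/funext => y; rewrite /f /phi indicE; case: (asboolP (U y)) => Uy.
    by rewrite rU// mulr0.
  by rewrite memNset// subr0 mul1r.
have Pr y : P r y = r y by rewrite -[in LHS]fE Pf.
pose w y := r y ^+ 2.
have bw : bounded_mfun w by exact: bounded_mfunX.
(* The second moment of [r(X_1) - r(y)] when [X_0 = y], expanded with [P r = r] and [P 1 = 1]. *)
have var y : P (fun z => (r z - r y) ^+ 2) y = P w y - w y.
  have -> : (fun z => (r z - r y) ^+ 2) =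
      fun z => (w z + (- 2 * r y) * r z) + (r y ^+ 2) * 1.
    by apply/funext => z; rewrite /w; ring.
  rewrite (smoD HP); [|by apply: bounded_mfunD => //; exact: bounded_mfunM|exact: bounded_mfunM].
  rewrite (smoD HP)//; last exact: bounded_mfunM.
  rewrite !(smoZ HP)// conservative Pr /w; ring.
have bsq y : bounded_mfun (fun z => (r z - r y) ^+ 2).
  by apply: bounded_mfunX; exact: bounded_mfunB.
have Pw y : P w y = w y.
  apply: subinvariant_invariant => //.
  - by move=> z; exact: (continuousM (cont_r z) (cont_r z)).
  - by move=> z; rewrite /w exprn_ge0//= exprn_ile1.
  - by move=> z; rewrite -subr_ge0 -var; apply: (smo_ge0 HP) => // t; exact: sqr_ge0.
(* The second moment vanishes, so [r] does not change along a step and can be pulled out of [P].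
   Instead of Cauchy-Schwarz, [|a| <= a^2 / e + e] is used for every e > 0: under [P] the quadratic
   term contributes 0. *)
have Prg g y : bounded_mfun g -> (forall z, 0 <= g z <= 1) ->
    P (fun z => r z * g z) y = r y * P g y.
  move=> bg g01.
  have brg : bounded_mfun (fun z => r z * g z) by exact: bounded_mfunM.
  have bryg : bounded_mfun (fun z => r y * g z) by exact: bounded_mfunM.
  apply/eqP; rewrite -subr_eq0 -normr_eq0 -(smoZ HP)// -(smoB HP)//.
  rewrite eq_le normr_ge0 andbT; apply/ler_addgt0Pl => e e0; rewrite addr0.
  have ebnd z : `|r z * g z - r y * g z| <= e^-1 * (r z - r y) ^+ 2 + e * 1.
    rewrite -mulrBl normrM (ger0_norm (proj1 (andP (g01 z)))).
    apply: (@le_trans _ _ `|r z - r y|).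
      by rewrite ler_piMr//; have /andP[] := g01 z.
    rewrite -(@real_normK _ (r z - r y)) ?num_real//.
    set a := `|r z - r y|; rewrite -(ler_pM2l e0) mulrDr mulrA divff ?gt_eqF// mul1r.
    have : 0 <= (a - e) ^+ 2 by exact: sqr_ge0.
    have : 0 <= a ^+ 2 by exact: sqr_ge0.
    rewrite mulr1; nra.
  have Pbnd : P (fun z => e^-1 * (r z - r y) ^+ 2 + e * 1) y = e.
    rewrite (smoD HP); [|exact: bounded_mfunM|exact: bounded_mfunM].
    by rewrite !(smoZ HP)// var Pw subrr mulr0 add0r conservative mulr1.
  have bb : bounded_mfun (fun z => e^-1 * (r z - r y) ^+ 2 + e * 1).
    by apply: bounded_mfunD; apply: bounded_mfunM.
  have bD : bounded_mfun (fun z => r z * g z - r y * g z) by exact: bounded_mfunB.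
  rewrite ler_norml; apply/andP; split.
    rewrite -[X in - X]Pbnd -mulN1r -(smoZ HP)//; apply: (smo_le HP) => //; first exact: bounded_mfunM.
    by move=> z; rewrite mulN1r lerNl; apply: le_trans (ebnd z); rewrite -normrN ler_norm.
  rewrite -[leRHS]Pbnd.
  by apply: (smo_le HP) => // z; apply: le_trans (ebnd z); rewrite ler_norm.
(* [r] is carried along the chain and vanishes on U, so from a point where it is nonzero the chain
   never enters U. Letting n grow turns this identity into [r^2 = r]. *)
have r_avoid n y : r y * avoid n y = r y.
  elim: n y => [|n IH] y; first by rewrite /avoid/= mulr1.
  rewrite /avoid /= -/(avoid n) /killed -Prg; last 2 first.
  - by apply: bcophi; exact: avoid_bounded.
  - by move=> z; apply: cophi01; exact: avoid01.
  rewrite -[RHS]Pr; congr P; apply/funext => z.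
  by rewrite mulrCA IH -[in RHS]fE.
have rr y : r y * r y = r y.
  have h : r y * avoid n y @[n --> \oo] --> r y * r y.
    by apply: cvgM; [exact: cvg_cst|exact: cr].
  apply: (cvg_unique _ h) => //.
  rewrite (_ : (fun n => _) = fun=> r y); first exact: cvg_cst.
  by apply/funext => n; exact: r_avoid.
have r_01 y : r y = 0 \/ r y = 1.
  have /eqP : r y * (r y - 1) = 0 by rewrite mulrBr mulr1 rr subrr.
  by rewrite mulf_eq0 subr_eq0 => /orP[/eqP|/eqP]; [left|right].
have [y Uy] := U0.
suff <- : r x = 0 by exact: cr.
by rewrite (continuous_zero_one_cst cont_r r_01 x y) rU.
Qed.

End avoidance.
End strong_feller.

(** * Functionals of bounded functions determined by indicators *)

Section bounded_functionals.
Context {d : measure_display} {T : measurableType d} {R : realType}.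

Lemma bounded_mfun_integrable (Q : probability T R) (D : set T) (f : T -> R) :
  measurable D -> bounded_mfun f -> Q.-integrable D (EFin \o f).
Proof.
move=> mD [mf [M fM]]; apply: measurable_bounded_integrable => //.
- by apply: (le_lt_trans (probability_le1 Q mD)); rewrite ltry.
- exact: measurable_funTS.
- exists M; split; first exact: num_real.
  by move=> N MN x _; exact: (le_trans (fM x) (ltW MN)).
Qed.

Lemma Rintegral_prob01 (Q : probability T R) (D : set T) (f : T -> R) :
  measurable D -> bounded_mfun f -> (forall x, 0 <= f x <= 1) ->
  0 <= \int[Q]_(x in D) f x <= 1.
Proof.
move=> mD bf f01; apply/andP; split.
  by apply: Rintegral_ge0 => x _; have /andP[] := f01 x.
apply: (@le_trans _ _ (\int[Q]_(x in D) cst 1 x)).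
  apply: le_Rintegral => //; [exact: bounded_mfun_integrable| |].
    by apply: bounded_mfun_integrable => //; exact: bounded_mfun_cst.
  by move=> x _; have /andP[] := f01 x.
rewrite Rintegral_cst// mul1r -lee_fin fineK; first exact: probability_le1.
by rewrite fin_num_measure.
Qed.

Lemma probability_setC_eq0 (Q : probability T R) (A : set T) : measurable A ->
  Q (~` A) = 0%E <-> Q A = 1%E.
Proof.
move=> mA; rewrite probability_setC//.
have fA : Q A \is a fin_num by rewrite fin_num_measure.
rewrite -(fineK fA) -EFinB; split => [[/eqP]|[->]]; last by rewrite subrr.
by rewrite subr_eq0 => /eqP <-.
Qed.

(* A bounded functional is determined by its values on indicators: with
   A = {g >= 1/2} the function g1 = 2g - 1_A is again [0, 1]-valued and
   g = (1_A + g1) / 2, which halves the discrepancy of the two functionals. *)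
Lemma bounded_functional_ext (F1 F2 : (T -> R) -> R) :
  (forall A, measurable A -> F1 \1_A = F2 \1_A) ->
  (forall F, F = F1 \/ F = F2 -> forall f g, bounded_mfun f -> bounded_mfun g ->
     F (fun x => 2^-1 * f x + 2^-1 * g x) = 2^-1 * F f + 2^-1 * F g) ->
  (forall F, F = F1 \/ F = F2 -> forall f, bounded_mfun f ->
     (forall x, 0 <= f x <= 1) -> 0 <= F f <= 1) ->
  forall f, bounded_mfun f -> (forall x, 0 <= f x <= 1) -> F1 f = F2 f.
Proof.
move=> Find Flin F01 f bf f01.
have key n g : bounded_mfun g -> (forall x, 0 <= g x <= 1) ->
    `|F1 g - F2 g| <= 2^-1 ^+ n.
  elim: n g => [|n IH] g bg g01.
    have /andP[? ?] := F01 F1 (or_introl erefl) g bg g01.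
    have /andP[? ?] := F01 F2 (or_intror erefl) g bg g01.
    by rewrite expr0 ler_norml; apply/andP; split; lra.
  pose A := [set x | 2^-1 <= g x].
  have mA : measurable A.
    rewrite -[A]setTI (_ : A = g @^-1` `[2^-1, +oo[).
      by apply: bg.1 => //; exact: measurable_itv.
    by apply/seteqP; split=> x; rewrite /A/= in_itv/= andbT.
  pose g1 x := 2 * g x - \1_A x.
  have bA : bounded_mfun (\1_A : T -> R) by exact: bounded_mfun_indic.
  have bg1 : bounded_mfun g1 by apply: bounded_mfunB => //; exact: bounded_mfunM.
  have g101 x : 0 <= g1 x <= 1.
    rewrite /g1 indicE; have /andP[? ?] := g01 x; have [Ax|Ax] /= := boolP (x \in A).
      by move: Ax; rewrite mulr1n inE /A/= => ?; apply/andP; split; lra.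
    have : g x < 2^-1 by rewrite ltNge; apply: contra Ax; rewrite inE.
    by rewrite mulr0n => ?; apply/andP; split; lra.
  have -> : g = fun x => 2^-1 * \1_A x + 2^-1 * g1 x.
    by apply/funext => x; rewrite /g1; field.
  rewrite (Flin F1 (or_introl erefl))// (Flin F2 (or_intror erefl))// (Find A)//.
  rewrite opprD addrACA subrr add0r -mulrBr normrM ger0_norm ?invr_ge0// exprS.
  by rewrite ler_pM2l//; exact: IH.
apply/eqP; rewrite -subr_eq0 -normr_eq0 eq_le normr_ge0 andbT.
have h : (2^-1 : R) ^+ n @[n --> \oo] --> 0.
  by apply: cvg_expr; rewrite ger0_norm ?invf_lt1 ?ltr1n.
apply: (@ler_cvg_to _ \oo _ R (fun=> `|F1 f - F2 f|) _ _ _ _ h); first exact: cvg_cst.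
by near=> n; exact: key.
Unshelve. all: by end_near. Qed.

End bounded_functionals.

(** * The Markov property and the last exit time *)

Section markov.
Context {R : realType} {d : nat}.
Local Notation Rd := 'rV[R]_d.
Local Notation RdD := (one_point_compactification 'rV[R]_d).
Context {dO : measure_display} {Omega : measurableType dO}.
Variables (Ft : R -> set (set Omega)) (X : R -> Omega -> RdD).
Variable Px : RdD -> probability Omega R.
Variable P : R -> (Rd -> R) -> Rd -> R.
Hypothesis hunt : hunt_process Ft X Px.
Hypothesis trans : transition X Px P.
Implicit Types f g : Rd -> R.

Lemma borelD_some (B : set Rd) : measurable B -> borelD (Some @` B : set RdD).
Proof.
move: B; apply: smallest_sub => [|U /= oU]; last first.
  by apply: sub_sigma_algebra; exact: one_point_compactification_open_some.
split.
- by rewrite /= image_set0; exact: sigma_algebra0.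
- move=> A bA /=.
  (* The complement taken in the compactification also contains the cemetery, which is Borel as the
     complement of the open set of all finite points. *)
  have -> : Some @` (setT `\` A) =
      ~` (Some @` A `|` ~` (Some @` [set: Rd])) :> set RdD.
    apply/seteqP; split.
      by move=> _ [x [_ Ax] <-] [[y Ay [yx]]|[]]; [apply: Ax; rewrite -yx|exists x].
    move=> [x|] /= /not_orP[h1 h2].
      by exists x => //; split => // Ax; apply: h1; exists x.
    by exfalso; apply: h2 => -[].
  apply: sigma_algebraC; rewrite -bigcup2E; apply: sigma_algebra_bigcup.
  move=> [|[|n]]//=; last exact: sigma_algebra0.
  apply: sigma_algebraC; apply: sub_sigma_algebra.
  by apply: one_point_compactification_open_some; exact: openT.
- by move=> A bA /=; rewrite image_bigcup; exact: sigma_algebra_bigcup.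
Qed.

Lemma borelDU (B C : set RdD) : borelD B -> borelD C -> borelD (B `|` C).
Proof.
move=> bB bC; rewrite -bigcup2E; apply: sigma_algebra_bigcup.
by move=> [|[|n]]//=; exact: sigma_algebra0.
Qed.

Lemma borelD_none : borelD [set (None : RdD)].
Proof.
have -> : [set None] = ~` (Some @` [set: Rd]) :> set RdD.
  apply/seteqP; split => [_ -> [x _]//|[x|//] h].
  by exfalso; apply: h; exists x.
by apply: sigma_algebraC; exact: borelD_some.
Qed.

Lemma process_measurable t B : 0 <= t -> borelD B -> measurable (X t @^-1` B).
Proof. by move=> t0 bB; apply: (Ft_measurable hunt t0); exact: (X_adapted hunt). Qed.

Lemma bounded_mfun_process t f : 0 <= t -> bounded_mfun f ->
  bounded_mfun (fun w => oapp f 0 (X t w)).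
Proof.
move=> t0 [mf [M fM]]; split; last first.
  exists (Num.max M 0) => w; rewrite le_max.
  by case: (X t w) => [x|] /=; rewrite ?fM// normr0 lexx orbT.
move=> _ Y mY; rewrite setTI.
have mfY : measurable (f @^-1` Y) by rewrite -[_ @^-1` _]setTI; exact: mf.
have -> : (fun w => oapp f 0 (X t w)) @^-1` Y =
    X t @^-1` (Some @` (f @^-1` Y) `|` (if `[< Y 0 >] then [set None] else set0)).
  apply/seteqP; split=> w /=; case: (X t w) => [x|] /=.
  - by move=> Yx; left; exists x.
  - by move=> Y0; right; case: asboolP.
  - by move=> [[y Yy [<-]]//|]; case: asboolP.
  - by move=> [[y]//|]; case: asboolP.
apply: process_measurable => //; apply: borelDU; first exact: borelD_some.
by case: asboolP => _; [exact: borelD_none|exact: sigma_algebra0].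
Qed.

Lemma transitionE t x f : 0 <= t -> bounded_mfun f ->
  P t f x = \int[Px (Some x)]_w oapp f 0 (X t w).
Proof. by move=> t0 [mf bf]; rewrite /Rintegral -(trans x t0 mf bf). Qed.

Lemma oapp_linear c (f g : Rd -> R) (y : RdD) :
  oapp (fun z => c * f z + g z) 0 y = c * oapp f 0 y + oapp g 0 y.
Proof. by case: y => //=; rewrite mulr0 addr0. Qed.

Lemma transition_linear t c f g x : 0 <= t -> bounded_mfun f -> bounded_mfun g ->
  P t (fun y => c * f y + g y) x = c * P t f x + P t g x.
Proof.
move=> t0 bf bg; rewrite !transitionE//; last first.
  by apply: bounded_mfunD => //; exact: bounded_mfunM.
have bXf := bounded_mfun_process t0 bf; have bXg := bounded_mfun_process t0 bg.
rewrite -RintegralZl//; last exact: bounded_mfun_integrable.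
rewrite -RintegralD//; [|exact: bounded_mfun_integrable (bounded_mfunM (bounded_mfun_cst c) bXf)|];
  last exact: bounded_mfun_integrable.
by apply: eq_Rintegral => w _; exact: oapp_linear.
Qed.

Lemma transition_ge0 t f x : 0 <= t -> bounded_mfun f -> (forall y, 0 <= f y) ->
  0 <= P t f x.
Proof.
move=> t0 bf f0; rewrite transitionE//; apply: Rintegral_ge0 => w _.
by case: (X t w).
Qed.

Lemma oapp01 (f : Rd -> R) (y : RdD) : (forall z, 0 <= f z <= 1) -> 0 <= oapp f 0 y <= 1.
Proof. by case: y => [z|] f01 /=; rewrite ?f01// lexx ler01. Qed.

Lemma transition01 t f x : 0 <= t -> bounded_mfun f -> (forall y, 0 <= f y <= 1) ->
  0 <= P t f x <= 1.
Proof.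
move=> t0 bf f01; rewrite transitionE//; apply: Rintegral_prob01 => //.
  exact: bounded_mfun_process.
by move=> w; exact: oapp01.
Qed.

Lemma process_cvg (Q : probability Omega R) t (fn : nat -> Rd -> R) f : 0 <= t ->
  (forall n, bounded_mfun (fn n)) -> (forall n y, 0 <= fn n y <= 1) ->
  (forall y, fn n y @[n --> \oo] --> f y) ->
  \int[Q]_w oapp (fn n) 0 (X t w) @[n --> \oo] --> \int[Q]_w oapp f 0 (X t w).
Proof.
move=> t0 bfn fn01 fnf.
have [bf f01] := bounded_mfun_cvg bfn fn01 fnf.
have bX g : bounded_mfun g -> bounded_mfun (fun w => oapp g 0 (X t w)).
  exact: bounded_mfun_process.
have h : (\int[Q]_w (oapp (fn n) 0 (X t w))%:E @[n --> \oo] -->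
    \int[Q]_w (oapp f 0 (X t w))%:E)%E.
  apply: (@dominated_cvg _ _ _ Q setT measurableT
    (fun n w => (oapp (fn n) 0 (X t w))%:E) _ (cst 1%E)) => //.
  - by move=> n; apply/measurable_EFinP; exact: (bX _ (bfn n)).1.
  - move=> w _; apply: cvg_EFin; first by near=> n.
    by case: (X t w) => [y|] /=; [exact: fnf|exact: cvg_cst].
  - exact: (bounded_mfun_integrable Q measurableT (bounded_mfun_cst 1)).
  - move=> n w _; rewrite lee_fin; have /andP[h0 h1] := oapp01 (X t w) (fn01 n).
    by rewrite ger0_norm.
apply: fine_cvg; rewrite fineK//.
by apply: integrable_fin_num => //; apply: bounded_mfun_integrable => //; exact: bX.
Unshelve. all: by end_near. Qed.

Lemma transition_cvg t (fn : nat -> Rd -> R) f x : 0 <= t ->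
  (forall n, bounded_mfun (fn n)) -> (forall n y, 0 <= fn n y <= 1) ->
  (forall y, fn n y @[n --> \oo] --> f y) ->
  P t (fn n) x @[n --> \oo] --> P t f x.
Proof.
move=> t0 bfn fn01 fnf.
have [bf _] := bounded_mfun_cvg bfn fn01 fnf.
rewrite transitionE// (_ : (fun n => _) =
  fun n => \int[Px (Some x)]_w oapp (fn n) 0 (X t w)); first exact: process_cvg.
by apply/funext => n; rewrite transitionE.
Qed.

Lemma process_indic t (B : set Rd) w :
  oapp (\1_B : Rd -> R) 0 (X t w) = \1_(X t @^-1` (Some @` B)) w.
Proof.
rewrite !indicE; case E : (X t w) => [y|] /=.
  rewrite indicE; congr (_%:R); congr nat_of_bool.
  apply/idP/idP; rewrite !inE /= E; first by exists y.
  by move=> [z Bz [<-]].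
by rewrite memNset//= E => -[].
Qed.

Lemma transition_indic t (B : set Rd) y : 0 <= t -> measurable B ->
  (P t \1_B y)%:E = Px (Some y) (X t @^-1` (Some @` B)).
Proof.
move=> t0 mB; have bB : bounded_mfun (\1_B : Rd -> R) by exact: bounded_mfun_indic.
rewrite transitionE// /Rintegral fineK; last first.
  apply: integrable_fin_num => //; apply: bounded_mfun_integrable => //.
  exact: bounded_mfun_process.
under eq_integral do rewrite process_indic.
rewrite integral_indic ?setIT//.
by apply: process_measurable => //; exact: borelD_some.
Qed.

(** The Markov property also involves the law started at the cemetery, about which [transition] is
    silent. Under it the path starts at [None], so its lifetime is 0 and absorption applies; this
    matches the convention f(Delta) = 0 encoded by [oapp f 0]. *)
Lemma none_absorbing t (B : set Rd) : 0 <= t -> measurable B ->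
  Px None (X t @^-1` (Some @` B)) = 0%E.
Proof.
move=> t0 mB.
have m0 : measurable [set w | X 0 w = None].
  exact: (process_measurable (lexx 0) borelD_none).
have c0 : Px None (~` [set w | X 0 w = None]) = 0%E.
  by apply/(probability_setC_eq0 _ m0); exact: (X_normal hunt).
apply: (subset_measure0 _ (measurableC m0) _ c0).
  by apply: process_measurable => //; exact: borelD_some.
move=> w [y By Xtw] /= X0w.
have : X t w = None.
  apply: (X_absorbed hunt) => //; apply: (@le_trans _ _ 0%E); last by rewrite lee_fin.
  by apply: ereal_inf_lbound; exists 0.
by rewrite -Xtw.
Qed.

(** The strong Markov property at the constant time s yields the case of indicators, and
    [bounded_functional_ext] extends it to functions. *)
Lemma markov_property s t x (Lam : set Omega) f : 0 <= s -> 0 <= t -> Ft s Lam ->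
  bounded_mfun f -> (forall y, 0 <= f y <= 1) ->
  (forall g, bounded_mfun g -> bounded_mfun (P t g)) ->
  \int[Px (Some x)]_(w in Lam) oapp f 0 (X (s + t) w) =
  \int[Px (Some x)]_(w in Lam) oapp (P t f) 0 (X s w).
Proof.
move=> s0 t0 Lams bf f01 bP.
have st0 : 0 <= s + t by rewrite addr_ge0.
have mLam : measurable Lam by exact: (Ft_measurable hunt s0).
pose Q := Px (Some x).
apply: (bounded_functional_ext
  (F1 := fun g => \int[Q]_(w in Lam) oapp g 0 (X (s + t) w))
  (F2 := fun g => \int[Q]_(w in Lam) oapp (P t g) 0 (X s w))) => //.
- move=> B mB; have bB : bounded_mfun (\1_B : Rd -> R) by exact: bounded_mfun_indic.
  congr fine.
  have -> : (\int[Q]_(w in Lam) (oapp (\1_B) 0 (X (s + t) w))%:E =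
      \int[Q]_(w in Lam) (\1_(X (s + t) @^-1` (Some @` B)) w)%:E)%E.
    by apply: eq_integral => w _; rewrite process_indic.
  have mXB : measurable (X (s + t) @^-1` (Some @` B)).
    by apply: process_measurable => //; exact: borelD_some.
  rewrite integral_indic//.
  have := @X_strong_markov _ _ _ _ _ _ _ hunt (fun=> s%:E) Lam (Some x) t
    (Some @` B) _ _ t0 (borelD_some mB).
  have -> : [set w : Omega | (s%:E < +oo)%E] = setT.
    by apply/seteqP; split=> // w _ /=; rewrite ltry.
  have -> : [set w | (s%:E < +oo)%E /\ (Some @` B) (X (fine s%:E + t) w)] =
      X (s + t) @^-1` (Some @` B).
    by apply/seteqP; split=> w /= => [[]//|?]; rewrite ltry.
  rewrite setIT setIC => SM; apply: (etrans (SM _ _)).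
  + split=> [w|u u0]; first by rewrite lee_fin.
    case: (leP s u) => su.
      rewrite (_ : [set _ | _] = setT); last first.
        by apply/seteqP; split=> // w _ /=; rewrite lee_fin.
      by have [h1 h2 _] := Ft_sigma_algebra hunt u0; rewrite -(setD0 setT); exact: h2.
    rewrite (_ : [set _ | _] = set0).
      by have [] := Ft_sigma_algebra hunt u0.
    by apply/seteqP; split=> // w /=; rewrite lee_fin leNgt su.
  + split=> // u u0; case: (leP s u) => su.
      rewrite (_ : [set _ | _] = setT); last first.
        by apply/seteqP; split=> // w _ /=; rewrite lee_fin.
      by rewrite setIT; exact: (Ft_mono hunt s0 su).
    rewrite (_ : [set _ | _] = set0) ?setI0.
      by have [] := Ft_sigma_algebra hunt u0.
    by apply/seteqP; split=> // w /=; rewrite lee_fin leNgt su.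
  + apply: eq_integral => w _ /=; case: (X s w) => [y|] /=; last exact: none_absorbing.
    exact/esym/transition_indic.
- have lin u g h : 0 <= u -> bounded_mfun g -> bounded_mfun h ->
      \int[Q]_(w in Lam) oapp (fun y => 2^-1 * g y + 2^-1 * h y) 0 (X u w) =
      2^-1 * \int[Q]_(w in Lam) oapp g 0 (X u w) +
      2^-1 * \int[Q]_(w in Lam) oapp h 0 (X u w).
    move=> u0 bg bh.
    have bXg := bounded_mfun_process u0 bg; have bXh := bounded_mfun_process u0 bh.
    rewrite -!RintegralZl//; [|exact: bounded_mfun_integrable|exact: bounded_mfun_integrable].
    rewrite -RintegralD//; [|exact: bounded_mfun_integrable (bounded_mfunM (bounded_mfun_cst _) bXg)
      |exact: bounded_mfun_integrable (bounded_mfunM (bounded_mfun_cst _) bXh)].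
    by apply: eq_Rintegral => w _; rewrite oapp_linear; case: (X u w) => //=; rewrite mulr0.
  move=> F [->|->] g h bg bh; first exact: lin.
  rewrite -lin//; [|exact: bP|exact: bP].
  apply: eq_Rintegral => w _; case: (X s w) => //= y.
  rewrite transition_linear//; last exact: bounded_mfunM.
  congr (_ + _).
  have := transition_linear 2^-1 y t0 bh (bounded_mfun_cst 0).
  have -> : P t (fun=> 0) y = 0.
    have := transition_linear (-1) y t0 (bounded_mfun_cst 0) (bounded_mfun_cst 0).
    by rewrite mulr0 addr0 mulN1r addNr.
  by rewrite addr0 => <-; congr P; apply/funext => z; rewrite addr0.
- move=> F [->|->] g bg g01; apply: Rintegral_prob01 => //.
  + exact: bounded_mfun_process.
  + by move=> w; exact: oapp01.
  + by apply: bounded_mfun_process => //; exact: bP.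
  + by move=> w; apply: oapp01 => y; exact: transition01.
Qed.

(** * Visits at integer times and the last exit time *)

Section last_exit.
Variable U : set Rd.
Hypothesis oU : open U.

(** As U is open and paths are continuous, a visit at some time t > m persists on a small interval,
    which contains a rational. This makes the event measurable. *)
Lemma last_exit_infiniteP w : last_exit X U w = +oo%E <->
  forall m : nat, exists2 q : rat, m%:R <= (ratr q : R) & (Some @` U) (X (ratr q) w).
Proof.
split=> [|h].
  rewrite /last_exit => Lw m.
  have mlt : (m%:R%:E < ereal_sup [set t%:E | t in
      [set t : R | (0 <= t)%R /\ (Some @` U) (X t w)]])%E.
    rewrite ltNge; apply/negP => le_m.
    have : (+oo <= m%:R%:E :> \bar R)%E.
      by rewrite -[leLHS]Lw ge_max le_m lee_fin ler0n.
    by rewrite leye_eq.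
  have [_ [t [t0 Ut] <-]] := ereal_sup_gt mlt; rewrite lte_fin => mt.
  have tpos : 0 < t by apply: le_lt_trans mt.
  (* Continuity is given only within [0, +oo[; at t > 0 it is ordinary continuity. *)
  have ct : {for t, continuous (X^~ w)}.
    have : {within [set t : R | 0 < t], continuous (X^~ w)}.
      apply: (continuous_subspaceW _ (@X_continuous _ _ _ _ _ _ _ hunt w)).
      by move=> u /= /ltW.
    by rewrite continuous_open_subspace; [apply; rewrite inE|exact: open_gt].
  have oSU : open (Some @` U : set RdD) by exact: one_point_compactification_open_some.
  have /nbhs_ballP[e /= e0 eU] := ct _ (open_nbhs_nbhs (conj oSU Ut)).
  have [q] := @rat_in_itvoo R t (t + e) (ltr_pwDr e0 (lexx t)).
  rewrite in_itv/= => /andP[tq qte]; exists q; first by rewrite ltW// (lt_trans mt).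
  apply: eU; rewrite /ball/= distrC gtr0_norm ?subr_gt0//.
  by rewrite ltrBlDl.
apply: eq_infty => r; rewrite /last_exit le_max; apply/orP; right.
have [q mq Uq] := h (Num.truncn r).+1.
have rq : r <= ratr q by apply: le_trans mq; apply/ltW; exact: truncnS_gt.
apply: (@le_trans _ _ (ratr q)%:E); first by rewrite lee_fin.
apply: ereal_sup_ubound; exists (ratr q) => //; split => //.
exact: le_trans (ler0n _ _) mq.
Qed.

Lemma measurable_last_exit_infinite : measurable [set w | last_exit X U w = +oo%E].
Proof.
have -> : [set w | last_exit X U w = +oo%E] =
    \bigcap_(m : nat) \bigcup_(q : rat)
      (if m%:R <= (ratr q : R) then X (ratr q) @^-1` (Some @` U) else set0).
  apply/seteqP; split=> w /=.
    move=> /last_exit_infiniteP h m _; have [q mq Uq] := h m.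
    by exists q => //; rewrite mq.
  move=> h; apply/last_exit_infiniteP => m.
  by have [q _] := h m I; case: ifP => // mq Uq; exists q.
apply: bigcapT_measurable => m; apply: countable_bigcupT_measurable => // q.
case: ifP => // mq; apply: process_measurable; first exact: le_trans (ler0n _ _) mq.
by apply: borelD_some; exact: open_measurable_rV.
Qed.

Variable mu : {measure set Rd -> \bar R}.
Hypothesis HP : sub_markov_operator mu (P 1).
Hypothesis P1 : forall x, P 1 (fun=> 1) x = 1.
Hypothesis avoid0 : forall x, avoid (P 1) U n x @[n --> \oo] --> 0.

Let bP f : bounded_mfun f -> bounded_mfun (P 1 f) := @smo_bounded _ _ _ _ _ HP f.
Let bavoid n : bounded_mfun (avoid (P 1) U n) := avoid_bounded HP oU n.

(** [P 1 1 = 1] and the Markov property propagate survival from time 0, where the path is at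
    [Some x], to every integer time. *)
Lemma alive_ae x n : Px (Some x) [set w | X n%:R w = None] = 0%E.
Proof.
have alive1 : \int[Px (Some x)]_w oapp (fun=> 1) 0 (X n%:R w) = 1.
  elim: n => [|n IH].
    transitivity (\int[Px (Some x)]_w cst 1 w); last first.
      rewrite Rintegral_cst// mul1r.
      exact: (congr1 fine (probability_setT (Px (Some x)))).
    congr fine; apply: ae_eq_integral => //.
    - by apply/measurable_EFinP; exact: (bounded_mfun_process (lexx 0) (bounded_mfun_cst 1)).1.
    - exact/measurable_EFinP.
    have mS : measurable [set w | X 0 w = Some x].
      have -> : [set w | X 0 w = Some x] = X 0 @^-1` (Some @` [set x]).
        by apply/seteqP; split=> w /=; [exists x|move=> [_ ->]].
      apply: process_measurable => //; apply: borelD_some.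
      rewrite -[[set x]]setCK; apply: measurableC; apply: open_measurable_rV.
      apply: closed_openC; apply: accessible_closed_set1.
      by apply: hausdorff_accessible; exact: norm_hausdorff.
    exists (~` [set w | X 0 w = Some x]); split.
    - exact: measurableC.
    - by apply/(probability_setC_eq0 _ mS); exact: (X_normal hunt).
    - by move=> w; apply: contra_not => /= X0 _; rewrite X0.
  apply: etrans IH; rewrite -natr1 (@markov_property n%:R 1)//.
  - by apply: eq_Rintegral => w _; case: (X n%:R w) => //= y; rewrite P1.
  - by have [h1 h2 _] := Ft_sigma_algebra hunt (ler0n R n); rewrite -(setD0 setT); exact: h2.
  - by move=> y; rewrite ler01 lexx.
have mN : measurable [set w | X n%:R w = None].
  exact: (process_measurable (ler0n _ n) borelD_none).
have : (\int[Px (Some x)]_w (\1_(~` [set w | X n%:R w = None]) w)%:E = 1)%E.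
  rewrite -[RHS](congr1 EFin alive1) /Rintegral fineK; last first.
    apply: integrable_fin_num => //; apply: bounded_mfun_integrable => //.
    exact: bounded_mfun_process.
  apply: eq_integral => w _; congr EFin; rewrite indicE.
  case E : (X n%:R w) => [y|] /=; first by rewrite mem_set//= E.
  by rewrite memNset//=; apply.
rewrite integral_indic//; last exact: measurableC.
rewrite setIT => alive_prob.
by rewrite -[X in Px _ X]setCK; apply/(probability_setC_eq0 _ (measurableC mN)).
Qed.

(** At the times m+1, ..., m+n the path is at a point outside U, hence also alive. The recursion
    makes each stage an event of time m+n. *)
Let stays m n := iteri n (fun i S => S `&` X (m + i.+1)%:R @^-1` (Some @` (~` U))) setT.

Let mCU : borelD (Some @` (~` U) : set RdD).
Proof. by apply: borelD_some; apply: measurableC; exact: open_measurable_rV. Qed.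

Let stays_Ft m n : Ft (m + n)%:R (stays m n).
Proof.
have FI k A B : Ft k%:R A -> Ft k%:R B -> Ft k%:R (A `&` B).
  have [F0 FC FU] := Ft_sigma_algebra hunt (ler0n R k) => FA FB.
  rewrite -[A `&` B]setCK setCI -setTD; apply: (FC).
  rewrite -bigcup2E; apply: FU => -[|[|i]]//=; by rewrite -setTD; exact: FC.
elim: n => [|n IH] /=.
  by have [h1 h2 _] := Ft_sigma_algebra hunt (ler0n R (m + 0)); rewrite -(setD0 setT); exact: h2.
apply: FI; last exact: (X_adapted hunt (ler0n _ _) mCU).
by apply: (Ft_mono hunt _ _ IH) => //; rewrite ler_nat addnS.
Qed.

Let staysS w m n : stays m n w -> forall j, (j < n)%N ->
  (Some @` (~` U)) (X (m + j.+1)%:R w).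
Proof.
elim: n => // n IH [/IH h hn] j; rewrite ltnS leq_eqVlt => /predU1P[->//|].
exact: h.
Qed.

Let stays_int x m n : \int[Px (Some x)]_w oapp (avoid (P 1) U n) 0 (X m%:R w) =
  \int[Px (Some x)]_(w in stays m n) oapp (fun=> 1) 0 (X (m + n)%:R w).
Proof.
(* Each application of the Markov property moves one killed step from the function [avoid] into the
   event [stays]. *)
suff key k i :
    \int[Px (Some x)]_(w in stays m i) oapp (avoid (P 1) U k) 0 (X (m + i)%:R w) =
    \int[Px (Some x)]_(w in stays m (i + k)) oapp (fun=> 1) 0 (X (m + (i + k))%:R w).
  by have := key n 0; rewrite addn0 add0n.
elim: k i => [|k IH] i; first by rewrite addn0.
pose g y : R := (1 - \1_U y) * avoid (P 1) U k y.
have bU : bounded_mfun (\1_U : Rd -> R).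
  exact: bounded_mfun_indic (open_measurable_rV oU).
have bg : bounded_mfun g by apply: bounded_mfunM => //; exact: bounded_mfunB.
have g01 y : 0 <= g y <= 1.
  rewrite /g indicE; have /andP[? ?] := avoid01 HP oU k y.
  by case: (y \in U); apply/andP; split; rewrite ?mulr1n ?mulr0n; lra.
transitivity (\int[Px (Some x)]_(w in stays m i) oapp g 0 (X (m + i.+1)%:R w)).
  rewrite addnS -natr1 (@markov_property (m + i)%:R 1)//.
rewrite -(addSnnS i k) -IH /= [RHS]Rintegral_mkcondr.
apply: eq_Rintegral => w _; rewrite /patch.
case E : (X (m + i.+1)%:R w) => [y|] /=; last by rewrite if_same.
rewrite /g indicE; case: (asboolP (U y)) => Uy.
  rewrite mem_set// subrr mul0r memNset//= E => -[z Uz [zy]].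
  by apply: Uz; rewrite zy.
rewrite memNset// subr0 mul1r mem_set//=.
by rewrite E; exists y.
Qed.

Let stays_null x m : Px (Some x) (\bigcap_n stays m n) = 0%E.
Proof.
pose a n := \int[Px (Some x)]_w oapp (avoid (P 1) U n) 0 (X m%:R w).
have a0 : a n @[n --> \oo] --> 0.
  have := @process_cvg (Px (Some x)) m%:R _ (fun=> 0) (ler0n _ _) bavoid
    (avoid01 HP oU) avoid0.
  rewrite (_ : \int[_]_w oapp (fun=> 0) 0 _ = 0)//.
  transitivity (\int[Px (Some x)]_w cst 0 w); last by rewrite Rintegral_cst// mul0r.
  by apply: eq_Rintegral => w _; case: (X m%:R w).
have mS n : measurable (stays m n).
  by apply: (Ft_measurable hunt (ler0n _ (m + n))); exact: stays_Ft.
have mI : measurable (\bigcap_n stays m n) by exact: bigcapT_measurable.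
(* The shift to [n.+1] matters: [stays m 0] is the whole space and says nothing about survival,
   whereas on [stays m n.+1] the path is alive at the final time and the integrand is 1. *)
have le_a n : (Px (Some x) (\bigcap_n stays m n) <= (a n.+1)%:E)%E.
  rewrite /a stays_int /Rintegral fineK; last first.
    apply: integrable_fin_num => //; apply: bounded_mfun_integrable => //.
    exact: bounded_mfun_process.
  have -> : (\int[Px (Some x)]_(w in stays m n.+1) (oapp (fun=> 1) 0 (X (m + n.+1)%:R w))%:E =
      \int[Px (Some x)]_(w in stays m n.+1) (cst 1 w))%E.
    apply: eq_integral => w; rewrite inE => /staysS/(_ n (ltnSn n)) [y _ <-] //.
  rewrite integral_cst// mul1e; apply: le_measure; rewrite ?inE//.
  exact: bigcap_inf.
apply/eqP; rewrite eq_le measure_ge0 andbT.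
have a0e : (a n.+1)%:E @[n --> \oo] --> 0%E.
  apply: cvg_EFin; first by near=> n.
  by have := a0; rewrite -(cvg_shiftS a).
apply: (lee_cvg_to (cvg_cst _) a0e).
by near=> n; exact: le_a.
Unshelve. all: by end_near. Qed.

Lemma last_exit_infinite_as x :
  Px (Some x) [set w | last_exit X U w = +oo%E] = 1%E.
Proof.
have mL := measurable_last_exit_infinite.
apply/(probability_setC_eq0 _ mL).
(* The exceptional paths: dead at some integer time, or outside U at all integer times after some
   n. *)
pose N := \bigcup_(n : nat) ([set w | X n%:R w = None] `|` \bigcap_k stays n k).
have mS m n : measurable (stays m n).
  by apply: (Ft_measurable hunt (ler0n _ (m + n))); exact: stays_Ft.
have mn n : measurable ([set w | X n%:R w = None] `|` \bigcap_k stays n k).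
  apply: measurableU; last exact: bigcapT_measurable.
  exact: (process_measurable (ler0n _ n) borelD_none).
have N0 : Px (Some x) N = 0%E.
  apply/negligibleP; first exact: bigcupT_measurable.
  apply: negligible_bigcup => n; apply: negligibleU; apply/negligibleP.
  - exact: (process_measurable (ler0n _ n) borelD_none).
  - exact: alive_ae.
  - exact: bigcapT_measurable.
  - exact: stays_null.
apply: (subset_measure0 _ _ _ N0); first exact: measurableC.
  exact: bigcupT_measurable.
move=> w; apply: contra_notP => Nw; apply/last_exit_infiniteP => m.
have alive n : X n%:R w <> None by move=> Xn; apply: Nw; exists n => //; left.
have [k Uk] : exists k, (Some @` U) (X (m + k.+1)%:R w).
  apply: contrapT => /forallNP noU; apply: Nw; exists m => //; right => n _.
  elim: n => // n IH; split => //=.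
  have := noU n; have := alive (m + n.+1)%N.
  case: (X (m + n.+1)%:R w) => [y _ nUy|[]//].
  by exists y => // Uy; apply: nUy; exists y.
exists ((m + k.+1)%:R : rat); rewrite ratr_nat//.
by rewrite ler_nat leq_addr.
Qed.

End last_exit.
End markov.

(** * The transition function as a version of the L^1 semigroup *)

Section semigroup_versions.
Context {R : realType} {d : nat}.
Local Notation Rd := 'rV[R]_d.
Context {dO : measure_display} {Omega : measurableType dO}.
Variables (X : R -> Omega -> one_point_compactification 'rV[R]_d).
Variable Ft : R -> set (set Omega).
Variable Px : one_point_compactification 'rV[R]_d -> probability Omega R.
Variable mu : {measure set Rd -> \bar R}.
Variables T P : R -> (Rd -> R) -> Rd -> R.
Hypothesis hunt : hunt_process Ft X Px.
Hypothesis trans : transition X Px P.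
Hypothesis semiT : sub_markovian_C0 mu T.
Hypothesis verP : continuous_version mu T P.
Implicit Types f g h : Rd -> R.

Local Notation I f := (\int[mu]_x (f x)%:E)%E.

Lemma dist_L1E f g : dist_Lp mu setT 1%E f g = I (fun x => `|f x - g x|).
Proof.
rewrite /dist_Lp Lnorm1; apply: eq_integral => x _ /=.
by rewrite indicE in_setT mulr1.
Qed.

Lemma norm1E f : ('N[mu]_1[EFin \o f])%E = I (fun x => `|f x|).
Proof. by rewrite Lnorm1. Qed.

Lemma Lfun1P f : f \in Lfun mu 1%E <->
  measurable_fun setT f /\ (I (fun x => `|f x|) < +oo)%E.
Proof.
split=> [/Lfun1_integrable/integrableP[/measurable_EFinP mf fi]//|[mf fi]].
by apply/Lfun1_integrable/integrableP; split => //; exact/measurable_EFinP.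
Qed.

Lemma Lfun1_linear c f g : f \in Lfun mu 1%E -> g \in Lfun mu 1%E ->
  (c \*o f \+ g) \in Lfun mu 1%E.
Proof.
move=> /Lfun1_integrable fi /Lfun1_integrable gi; apply/Lfun1_integrable.
have := integrableD measurableT (integrableZl measurableT c fi) gi.
by apply: eq_integrable => // x _ /=; rewrite EFinD EFinM.
Qed.

Lemma int_norm_triangle f g h : measurable_fun setT f -> measurable_fun setT g ->
  measurable_fun setT h ->
  (I (fun x => `|f x - h x|%R) <=
   I (fun x => `|f x - g x|%R) + I (fun x => `|g x - h x|%R))%E.
Proof.
move=> mf mg mh.
have m (u v : Rd -> R) : measurable_fun setT u -> measurable_fun setT v ->
    measurable_fun setT (fun x => (`|u x - v x|)%:E).
  by move=> mu' mv; apply/measurable_EFinP; apply: measurableT_comp => //; exact: measurable_funB.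
rewrite -ge0_integralD//; [|exact: m|exact: m].
apply: ge0_le_integral => //; [exact: m| |].
  by apply: emeasurable_funD; exact: m.
by move=> x _; rewrite -EFinD lee_fin (le_trans _ (ler_normD _ _))// addrA subrK.
Qed.

Lemma bounded_mfun_Lfuny f : bounded_mfun f -> f \in Lfun mu +oo%E.
Proof.
move=> [mf [M fM]]; rewrite inE; apply/andP; split; rewrite inE//=.
rewrite /finite_norm unlock /Lnorm; case: ifPn => [mu0|_]; last by rewrite ltry.
apply: (@le_lt_trans _ _ M%:E); last by rewrite ltry.
by apply/ess_supP; apply/nearW => x /=; rewrite lee_fin.
Qed.

(** The strong Feller property: a bounded Borel function lies in L^oo, where [P t] selects a
    continuous version. *)
Lemma P_feller t f : 0 < t -> bounded_mfun f -> continuous (P t f).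
Proof.
move=> t0 /bounded_mfun_Lfuny; apply: (P_continuous verP) => //.
by rewrite leey.
Qed.

Lemma P_bounded t f : 0 < t -> bounded_mfun f -> bounded_mfun (P t f).
Proof.
move=> t0 bf; split; first by apply: continuous_measurable_rV; exact: P_feller.
have bX := bounded_mfun_process hunt (ltW t0) bf.
have [_ [M XM]] := bX; exists M => x.
rewrite (transitionE trans x (ltW t0) bf).
have := le_normr_Rintegral measurableT (bounded_mfun_integrable (Px (Some x)) measurableT bX).
move/le_trans; apply.
apply: (@le_trans _ _ (\int[Px (Some x)]_w cst M w)).
  apply: le_Rintegral => //.
  + exact: (bounded_mfun_integrable _ measurableT (bounded_mfun_norm bX)).
  + exact: (bounded_mfun_integrable _ measurableT (bounded_mfun_cst M)).
rewrite Rintegral_cst// (_ : fine _ = 1) ?mulr1//.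
exact: (congr1 fine (probability_setT (Px (Some x)))).
Qed.

Lemma P_Lfun1 t f : 0 < t -> f \in Lfun mu 1%E -> P t f \in Lfun mu 1%E.
Proof. by move=> t0 fi; have [] := P_version verP (lexx 1%E) t0 fi. Qed.

(** [Ls_semigroup] reaches [P t f] only through approximations in the intersection of L^1 and L^oo.
    By contractivity their images converge in L^1 to [T t f] too, and L^1 limits agree almost
    everywhere. *)
Lemma P_ae_T t f : 0 < t -> f \in Lfun mu 1%E -> \forall x \ae mu, P t f x = T t f x.
Proof.
move=> t0 fi; have [Pfi [fn [fnL fnf Tfnf]]] := P_version verP (lexx 1%E) t0 fi.
have mL g : g \in Lfun mu 1%E -> measurable_fun setT g by move=> /Lfun1P[].
have Tfi := sg_L1 semiT t0 fi.
have Tfni n := sg_L1 semiT t0 (fnL n).1.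
have le_n n : (I (fun x => `|P t f x - T t f x|) <=
    dist_Lp mu setT 1%E (T t (fn n)) (P t f) + dist_Lp mu setT 1%E (fn n) f)%E.
  rewrite !dist_L1E; apply: le_trans (int_norm_triangle (mL _ Pfi) (mL _ (Tfni n)) (mL _ Tfi)) _.
  rewrite (_ : I (fun x => `|P t f x - T t (fn n) x|) =
      I (fun x => `|T t (fn n) x - P t f x|)); last first.
    by apply: eq_integral => x _; rewrite distrC.
  rewrite leeD2l//.
  have -> : I (fun x => `|T t (fn n) x - T t f x|) =
      I (fun x => `|T t ((-1) \*o f \+ fn n) x|).
    have Tli := sg_L1 semiT t0 (Lfun1_linear (-1) fi (fnL n).1).
    apply: ge0_ae_eq_integral => //.
    - apply/measurable_EFinP; apply: measurableT_comp => //.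
      by apply: measurable_funB; exact: mL.
    - by apply/measurable_EFinP; apply: measurableT_comp => //; exact: mL.
    have := sg_linear semiT (-1) t0 fi (fnL n).1.
    by apply: filterS => x h _ /=; rewrite h//= mulN1r addrC.
  have := sg_contraction semiT t0 (Lfun1_linear (-1) fi (fnL n).1).
  rewrite !norm1E => /le_trans; apply.
  rewrite le_eqVlt; apply/orP; left; apply/eqP.
  by apply: eq_integral => x _ /=; rewrite mulN1r addrC.
have cv : (dist_Lp mu setT 1%E (T t (fn n)) (P t f) + dist_Lp mu setT 1%E (fn n) f)%E
    @[n --> \oo] --> 0%E.
  by rewrite -[X in _ --> X]adde0; apply: cvgeD.
have I0 : I (fun x => `|P t f x - T t f x|) = 0%E.
  apply/eqP; rewrite eq_le integral_ge0 ?andbT//.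
  by apply: (lee_cvg_to (cvg_cst _) cv); near=> n; exact: le_n.
have mD : measurable_fun setT (fun x => (P t f x - T t f x)%:E).
  by apply/measurable_EFinP; apply: measurable_funB; exact: mL.
have := (ae_eq_integral_abs mu measurableT mD).1 I0.
apply: filterS => x /(_ Logic.I) /= [] /eqP; rewrite subr_eq0 => /eqP. exact.
Unshelve. all: by end_near. Qed.

Lemma bounded_Lfun1 f : bounded_mfun f -> (I (fun x => `|f x|) < +oo)%E ->
  f \in Lfun mu 1%E.
Proof. by move=> [mf _] fi; apply/Lfun1P. Qed.

Lemma P_sub_markov t : 0 < t -> sub_markov_operator mu (P t).
Proof.
move=> t0; have t0' := ltW t0; split.
- by move=> f; exact: P_bounded.
- by move=> c f g x bf bg; exact: (transition_linear hunt trans).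
- by move=> f x bf f0; exact: (transition_ge0 trans).
- move=> x; have one01 (y : Rd) : 0 <= (1 : R) <= 1 by rewrite ler01 lexx.
  by have /andP[] := transition01 hunt trans x t0' (bounded_mfun_cst 1) one01.
- by move=> fn f x bfn fn01 h; exact: (transition_cvg hunt trans).
- move=> f bf f0; have [fi|] := ltP (I f) +oo%E; last by rewrite leye_eq => /eqP ->; rewrite leey.
  have E g : (forall y, 0 <= g y) -> I (fun x => `|g x|) = I g.
    by move=> g0; apply: eq_integral => x _; rewrite ger0_norm.
  have fL : f \in Lfun mu 1%E by apply: bounded_Lfun1 => //; rewrite E.
  have Pf0 y : 0 <= P t f y by exact: (transition_ge0 trans).
  rewrite -(E f)// -(E (P t f))//.
  have := sg_contraction semiT t0 fL; rewrite !norm1E; apply: le_trans.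
  have mT : measurable_fun setT (T t f) by have /Lfun1P[] := sg_L1 semiT t0 fL.
  have mP : measurable_fun setT (P t f) by have /Lfun1P[] := P_Lfun1 t0 fL.
  rewrite le_eqVlt; apply/orP; left; apply/eqP; apply: ge0_ae_eq_integral => //.
  + by apply/measurable_EFinP; exact: measurableT_comp.
  + by apply/measurable_EFinP; exact: measurableT_comp.
  by have := P_ae_T t0 fL; apply: filterS => x -> _.
Qed.

Lemma P_semigroup_ae s t f : 0 < s -> 0 < t -> bounded_mfun f -> f \in Lfun mu 1%E ->
  \forall x \ae mu, P (s + t) f x = P s (P t f) x.
Proof.
move=> s0 t0 bf fL.
have PfL := P_Lfun1 t0 fL; have TfL := sg_L1 semiT t0 fL.
have h1 := P_ae_T (addr_gt0 s0 t0) fL.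
have h2 := sg_semigroup semiT s0 t0 fL.
have h3 : P t f = T t f %[ae mu].
  by have := P_ae_T t0 fL; apply: filterS => x h _.
have h4 := sg_ae semiT s0 PfL TfL h3.
have h5 := P_ae_T s0 PfL.
near=> x.
have -> : P (s + t) f x = T (s + t) f x by near: x.
have -> : T (s + t) f x = T s (T t f) x by near: x; apply: filterS h2 => x; apply.
have -> : P s (P t f) x = T s (P t f) x by near: x.
by near: x; apply: filterS h4 => x h; rewrite (h Logic.I).
Unshelve. all: by end_near. Qed.

Definition pos_mass f := I (fun x => Num.max (f x) 0).

Lemma pos_mass_ge0 f : (0 <= pos_mass f)%E.
Proof. by apply: integral_ge0 => x _; rewrite lee_fin le_max lexx orbT. Qed.

Lemma pos_mass_le f g h : measurable_fun setT f -> measurable_fun setT g ->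
  measurable_fun setT h -> (\forall x \ae mu, f x <= g x + h x) ->
  (pos_mass f <= pos_mass g + pos_mass h)%E.
Proof.
move=> mf mg mh fgh.
have m (u : Rd -> R) : measurable_fun setT u ->
    measurable_fun setT (fun x => (Num.max (u x) 0)%:E : \bar R).
  by move=> mu'; apply/measurable_EFinP; exact: measurable_maxr.
have p (u : Rd -> R) x : [set: Rd] x -> (0 <= (Num.max (u x) 0)%:E)%E.
  by rewrite lee_fin le_max lexx orbT.
rewrite /pos_mass -(ge0_integralD mu measurableT (p g) (m _ mg) (p h) (m _ mh)).
apply: (ae_ge0_le_integral measurableT (p f) (m _ mf)).
- by move=> x _; rewrite adde_ge0// p.
- by apply: emeasurable_funD; exact: m.
apply: filterS fgh => x h1 _; rewrite -EFinD lee_fin.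
have h2 : g x <= Num.max (g x) 0 by rewrite le_max lexx.
have h3 : h x <= Num.max (h x) 0 by rewrite le_max lexx.
have h4 : 0 <= Num.max (g x) 0 by rewrite le_max lexx orbT.
have h5 : 0 <= Num.max (h x) 0 by rewrite le_max lexx orbT.
by rewrite ge_max; apply/andP; split; lra.
Qed.

(** Positivity gives [(P f)^+ <= P (f^+)], to which contractivity applies. *)
Lemma pos_mass_P t f : 0 < t -> bounded_mfun f -> (pos_mass (P t f) <= pos_mass f)%E.
Proof.
move=> t0 bf; have HP := P_sub_markov t0.
have bm : bounded_mfun (fun x => Num.max (f x) 0) by exact: bounded_mfun_max.
apply: le_trans (smo_contraction HP bm _); last by move=> x; rewrite le_max lexx orbT.
apply: int_le => [|||x].
- by apply: bounded_mfun_max => //; exact: P_bounded.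
- exact: P_bounded.
- by move=> x; rewrite le_max lexx orbT.
- rewrite ge_max (smo_le HP)//=; first by apply: (smo_ge0 HP) => // y; rewrite le_max lexx orbT.
  by move=> y; rewrite le_max lexx.
Qed.

Lemma pos_mass_telescope (h : R) f k : 0 < h -> bounded_mfun f -> f \in Lfun mu 1%E ->
  (pos_mass (fun x => (f x - P (k.+1%:R * h) f x)%R) <=
   k.+1%:R%:E * pos_mass (fun x => (f x - P h f x)%R))%E.
Proof.
move=> h0 bf fL; elim: k => [|k IH]; first by rewrite !mul1r mul1e.
have kh0 : 0 < k.+1%:R * h by rewrite mulr_gt0.
have HP := P_sub_markov h0.
have bPf u : 0 < u -> bounded_mfun (P u f) by move=> u0; exact: P_bounded.
have kE : k.+2%:R * h = h + k.+1%:R * h by rewrite -natr1 mulrDl mul1r addrC.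
have bg : bounded_mfun (fun y => f y - P (k.+1%:R * h) f y).
  by apply: bounded_mfunB => //; exact: bPf.
apply: (@le_trans _ _ (pos_mass (fun x => (f x - P h f x)%R) +
   pos_mass (P h (fun y => (f y - P (k.+1%:R * h) f y)%R)))%E).
  apply: pos_mass_le.
  - by apply: (bounded_mfunB bf _).1; apply: bPf; rewrite mulr_gt0.
  - by apply: (bounded_mfunB bf _).1; exact: bPf.
  - by apply: (P_bounded h0 _).1.
  - have := P_semigroup_ae h0 kh0 bf fL; apply: filterS => x.
    rewrite -kE => ->; rewrite (smoB HP)//; last exact: bPf.
    by rewrite addrA subrK.
rewrite -[in leRHS]natr1 EFinD ge0_muleDl ?lee_fin// mul1e addeC leeD2r//.
apply: le_trans IH; exact: pos_mass_P.
Qed.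

(* f - T_1 f telescopes into sums of T_(i/m) (f - T_(1/m) f), and T_(i/m) does not
   increase the mass of the positive part; let m tend to infinity. *)
Lemma pos_mass_generator f w : bounded_mfun f -> sg_generator mu T f w ->
  (pos_mass (fun x => (f x - P 1 f x)%R) <= pos_mass (fun x => (- w x)%R))%E.
Proof.
move=> bf [fL wL cv].
have mw : measurable_fun setT w by have /Lfun1P[] := wL.
pose D (h : R) := dist_Lp mu setT 1%E (h^-1 \*o (T h f \- f)) w.
have le_h m : (pos_mass (fun x => (f x - P 1 f x)%R) <=
    pos_mass (fun x => (- w x)%R) + D (m.+1%:R^-1)%R)%E.
  set h : R := m.+1%:R^-1; have h0 : 0 < h by rewrite invr_gt0.
  have mh : m.+1%:R * h = 1 by rewrite divff.
  have := pos_mass_telescope m h0 bf fL; rewrite mh => /le_trans; apply.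
  have bPf : bounded_mfun (P h f) by exact: P_bounded.
  have TfL := sg_L1 semiT h0 fL.
  have mT : measurable_fun setT (T h f) by have /Lfun1P[] := TfL.
  have bfP : bounded_mfun (fun x => f x - P h f x) by exact: bounded_mfunB.
  rewrite /pos_mass -intZ//; last 2 first.
  - exact: bounded_mfun_max.
  - by move=> x; rewrite le_max lexx orbT.
  rewrite /D dist_L1E.
  have mq : measurable_fun setT (fun x => (h^-1 \*o (T h f \- f)) x - w x).
    apply: measurable_funB => //; apply: measurable_funM => //.
    by apply: measurable_funB => //; case: bf.
  have pmax u x : [set: Rd] x -> (0 <= (Num.max (u x : R) 0)%:E)%E.
    by rewrite lee_fin le_max lexx orbT.
  have mmax u : measurable_fun setT u -> measurable_fun setT (fun x : Rd => (Num.max (u x : R) 0)%:E).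
    by move=> mu'; apply/measurable_EFinP; exact: measurable_maxr.
  have pnorm u x : [set: Rd] x -> (0 <= `|u x : R|%:E)%E by rewrite lee_fin.
  have mnorm u : measurable_fun setT u -> measurable_fun setT (fun x : Rd => `|u x : R|%:E).
    by move=> mu'; apply/measurable_EFinP; exact: measurableT_comp.
  have mNw : measurable_fun setT (fun x => - w x) by exact: measurableT_comp.
  rewrite -(ge0_integralD mu measurableT (pmax _) (mmax _ mNw) (pnorm _) (mnorm _ mq)).
  apply: (ae_ge0_le_integral measurableT).
  - by move=> x _; rewrite lee_fin mulr_ge0// le_max lexx orbT.
  - apply/measurable_EFinP; apply: measurable_funM => //; apply: measurable_maxr => //.
    by case: bfP.
  - by move=> x _; rewrite adde_ge0// lee_fin// le_max lexx orbT.
  - by apply: emeasurable_funD; [exact: mmax _ mNw|exact: mnorm _ mq].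
  have := P_ae_T h0 fL; apply: filterS => x -> _; rewrite -EFinD lee_fin /=.
  have hE : h^-1 = m.+1%:R by rewrite invrK.
  rewrite hE; set c : R := m.+1%:R; set u := T h f x.
  have c0 : 0 <= c by rewrite ler0n.
  have h1 : `|c * (u - f x) - w x| >= - (c * (u - f x) - w x) by rewrite -normrN ler_norm.
  have h2 : 0 <= `|c * (u - f x) - w x| by [].
  have h3 : - w x <= Num.max (- w x) 0 by rewrite le_max lexx.
  have h4 : 0 <= Num.max (- w x) 0 by rewrite le_max lexx orbT.
  rewrite maxr_pMr// mulr0 ge_max; apply/andP; split; last by lra.
  lra.
have cvD : (pos_mass (fun x => (- w x)%R) + D (m.+1%:R^-1)%R)%E @[m --> \oo]
    --> pos_mass (fun x => (- w x)%R).
  rewrite -[X in _ --> X]adde0; apply: cvgeD => //.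
  - by rewrite fin_num_adde_defl.
  - exact: cvg_cst.
  - apply: ((cvge_at_rightP _ _ _).1 cv (fun m => m.+1%:R^-1)); split=> [m|].
      by rewrite invr_gt0.
    exact: cvg_harmonic.
by apply: (lee_cvg_to (cvg_cst _) cvD); near=> n; exact: le_h.
Unshelve. all: by end_near. Qed.

End semigroup_versions.

(** * The test functions *)

Section flat.
Context {R : realType}.
Implicit Types (k : nat) (y s : R).

(* The derivatives of [flat 0] are linear combinations of these functions. *)
Definition flat k y : R := if 0 < y then y ^- k * expR (- y^-1) else 0.

Lemma flat_ge0 k y : 0 <= flat k y.
Proof.
by rewrite /flat; case: ifP => // y0; rewrite mulr_ge0 ?expR_ge0// invr_ge0 exprn_ge0// ltW.
Qed.

Lemma flatS k y : flat k y = y * flat k.+1 y.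
Proof.
rewrite /flat; case: ifP => y0; last by rewrite mulr0.
by rewrite mulrA exprS invfM mulrA divff ?gt_eqF// mul1r.
Qed.

(** For y > 0, exp (1 / y) dominates its Taylor term of order k + 1. *)
Lemma flat_le k y : flat k y <= k.+1`!%:R * `|y|.
Proof.
rewrite /flat; case: ifP => y0; last by rewrite mulr_ge0.
rewrite gtr0_norm// expRN -ler_pdivrMl ?ltr0n ?fact_gt0//.
have yV : 0 <= y^-1 by rewrite invr_ge0 ltW.
have := expR_ge1Dxn k yV.
set e := expR y^-1 => he.
have e0 : 0 < e by exact: expR_gt0.
rewrite mulrA ler_pdivrMr//.
have h : y ^- k.+1 / k.+1`!%:R <= e.
  by rewrite -exprVn; lra.
have -> : k.+1`!%:R^-1 * y ^- k = y * (y ^- k.+1 / k.+1`!%:R).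
  by rewrite exprS invfM !mulrA divff ?gt_eqF// mul1r mulrC.
by rewrite ler_pM2l.
Qed.

Lemma is_derive_flat k y : is_derive y 1 (flat k) (flat k.+2 y - k%:R * flat k.+1 y).
Proof.
case: (ltrgt0P y) => [y0|y0|->].
- apply: (@near_eq_is_derive _ _ _ (fun y => y ^- k * expR (- y^-1))).
    near=> z; rewrite /flat ifT//; near: z; exact: lt_nbhsr.
  have dV : is_derive y 1 (fun z : R => z^-1) (- y ^- 2).
    have := @is_deriveV R id y 1 1 (lt0r_neq0 y0) (is_derive_id y 1).
    by rewrite /GRing.scale /= mulr1.
  have dX : is_derive y 1 (fun z : R => z ^- k) (- k%:R * y ^- k.+1).
    case: k => [|k].
      rewrite (_ : (fun z => _) = cst 1); last by apply/funext => z /=; rewrite expr0 invr1.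
      by rewrite oppr0 mul0r; exact: is_derive_cst.
    rewrite (_ : (fun z => _) = (fun z : R => z^-1) ^+ k.+1); last first.
      by apply/funext => z; rewrite fctE -exprVn.
    refine (is_derive_eq (is_deriveX k.+1 dV) _).
    rewrite /GRing.scale /= !exprS !exprVn; field.
    by rewrite ?gt_eqF ?exprn_gt0.
  have dE : is_derive y 1 (fun z : R => expR (- z^-1)) (expR (- y^-1) * y ^- 2).
    apply: (is_derive1_comp (f := expR) (g := fun z => - z^-1)).
    rewrite -[y ^- 2]opprK; exact: is_deriveN.
  refine (is_derive_eq (is_deriveM dX dE) _).
  rewrite /GRing.scale /= /flat y0 !exprS; field.
  by rewrite ?gt_eqF ?exprn_gt0.
- apply: (@near_eq_is_derive _ _ _ (cst 0)).
    near=> z; rewrite /flat ifF//; apply/negbTE; rewrite -leNgt ltW//.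
    by near: z; exact: lt_nbhsl.
  rewrite /flat !ifF ?mulr0 ?subr0; first exact: is_derive_cst.
    by apply/negbTE; rewrite -leNgt ltW.
  by apply/negbTE; rewrite -leNgt ltW.
(* At 0 the difference quotient of [flat k] is [flat k.+1], which is O(|h|): the derivative there
   exists and is 0. *)
- rewrite /flat ltxx mulr0 subr0.
  have cv : (fun h => h^-1 *: (flat k (h *: 1 + 0) - flat k 0)) @ 0^' --> (0 : R).
    have bnd h : h != 0 -> h^-1 *: (flat k (h *: 1 + 0) - flat k 0) = flat k.+1 h.
      move=> h0; rewrite {2}/flat ltxx subr0 addr0 /GRing.scale /= mulr1.
      by rewrite flatS mulrA mulVf// mul1r.
    apply: (@squeeze_cvgr _ _ _ _ (cst 0) (fun h => k.+2`!%:R * `|h|)).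
    - near=> h; rewrite bnd; last by near: h; exact: nbhs_dnbhs_neq.
      by rewrite flat_ge0 flat_le.
    - exact: cvg_cst.
    - rewrite [X in _ --> X](_ : 0 = k.+2`!%:R * `|0 : R|); last by rewrite normr0 mulr0.
      apply: cvgM; first exact: cvg_cst.
      by apply: cvg_norm; apply: cvg_within_filter; exact: cvg_id.
  by apply: DeriveDef; [exact: cvgP cv|exact: cvg_lim].
Unshelve. all: by end_near. Qed.

End flat.

(** * Radial functions, their smoothness and the operator L on them *)

Section radial.
Context {R : realType} {d : nat}.
Local Notation Rd := 'rV[R]_d.
Implicit Types (f g : Rd -> R) (x : Rd) (s : R).

Definition has_grad f (df : 'I_d -> Rd -> R) :=
  (forall x, differentiable f x) /\ forall i x, pd i f x = df i x.

Lemma has_grad_cst (c : R) : has_grad (fun=> c) (fun _ _ => 0).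
Proof.
split=> [x|i x]; first exact: differentiable_cst.
by rewrite /pd derive_cst.
Qed.

Lemma has_grad_coord j : has_grad (fun x => x 0 j) (fun i _ => (i == j)%:R).
Proof.
split=> [x|i x]; first exact: differentiable_coord.
rewrite /pd /derive; apply: cvg_lim => //.
apply: (@cvg_trans _ ((fun=> (i == j)%:R : R) @ (0 : R)^')); last exact: cvg_cst.
apply: near_eq_cvg; near=> h.
have h0 : h != 0 by near: h; exact: nbhs_dnbhs_neq.
rewrite /= !mxE eqxx /= addrK /GRing.scale /= mulrA mulVf// mul1r.
by rewrite eq_sym.
Unshelve. all: by end_near. Qed.

Lemma has_gradD f g df dg : has_grad f df -> has_grad g dg ->
  has_grad (fun x => f x + g x) (fun i x => df i x + dg i x).
Proof.
move=> [ff fE] [gg gE]; split=> [x|i x]; first exact: (differentiableD (ff x) (gg x)).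
rewrite -fE -gE; apply: (@deriveD _ _ _ f g); exact: diff_derivable.
Qed.

Lemma has_gradM f g df dg : has_grad f df -> has_grad g dg ->
  has_grad (fun x => f x * g x) (fun i x => f x * dg i x + g x * df i x).
Proof.
move=> [ff fE] [gg gE]; split=> [x|i x]; first exact: (differentiableM (ff x) (gg x)).
rewrite -fE -gE; apply: (@deriveM _ _ f g); exact: diff_derivable.
Qed.

Lemma has_grad_comp (h dh : R -> R) f df : has_grad f df ->
  (forall x, is_derive (f x) 1 h (dh (f x))) ->
  has_grad (fun x => h (f x)) (fun i x => dh (f x) * df i x).
Proof.
move=> [ff fE] hd; split=> [x|i x].
  apply: (differentiable_comp (ff x)); apply/derivable1_diffP.
  by have [] := hd x.
have dhx : differentiable h (f x) by apply/derivable1_diffP; have [] := hd x.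
rewrite -fE /pd (_ : (fun x => h (f x)) = h \o f)// deriveE; last first.
  exact: differentiable_comp.
rewrite diff_comp//= diff1E// derive1E (deriveE _ (ff x)).
by have [_ ->] := hd x; rewrite mulrC.
Qed.

Lemma has_grad_sum n (f : 'I_n -> Rd -> R) df : (forall k, has_grad (f k) (df k)) ->
  has_grad (fun x => \sum_k f k x) (fun i x => \sum_k df k i x).
Proof.
elim: n f df => [|n IH] f df fdf.
  rewrite (_ : (fun x => _) = fun=> 0); last by apply/funext => x; rewrite big_ord0.
  have [h1 h2] := has_grad_cst 0; split => // i x; rewrite h2 big_ord0//.
rewrite (_ : (fun x => _) = fun x => \sum_(k < n) f (widen_ord (leqnSn n) k) x + f ord_max x).
  have [h1 h2] := has_gradD (IH _ _ (fun k => fdf (widen_ord (leqnSn n) k))) (fdf ord_max).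
  by split => // i x; rewrite h2 big_ord_recr.
by apply/funext => x; rewrite big_ord_recr.
Qed.

Lemma dot_ge0 x : 0 <= dot x x.
Proof. by apply: sumr_ge0 => i _; rewrite -expr2 sqr_ge0. Qed.

Lemma has_grad_sq : has_grad (fun x => dot x x) (fun i x => 2 * x 0 i).
Proof.
have [h1 h2] := has_grad_sum (fun k => has_gradM (has_grad_coord k) (has_grad_coord k)).
split=> // i x; rewrite h2 (bigD1 i)//= eqxx big1 => [|k ki].
  by rewrite mulr1 addr0 mulr2n mulrDl mul1r.
by rewrite eq_sym (negbTE ki) !mulr0 addr0.
Qed.

Definition rad_a s : R := (1 + s)^-1.
Definition rad_b s : R := (1 + ln (1 + s))^-1.
Definition rad_m s : R := ln (1 + ln (1 + s)).

Lemma ln1_ge0 s : 0 <= s -> 0 <= ln (1 + s).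
Proof. by move=> s0; rewrite ln_ge0// lerDl. Qed.

Lemma rad_m_ge0 s : 0 <= s -> 0 <= rad_m s.
Proof. by move=> s0; rewrite ln1_ge0// ln1_ge0. Qed.

Lemma rad_a_gt0 s : 0 <= s -> 0 < rad_a s.
Proof. by move=> s0; rewrite invr_gt0 ltr_pwDl. Qed.

Lemma rad_b_gt0 s : 0 <= s -> 0 < rad_b s.
Proof. by move=> s0; rewrite invr_gt0 ltr_pwDl// ln1_ge0. Qed.

Lemma is_derive_1D s : is_derive s 1 (fun t : R => 1 + t) 1.
Proof.
refine (is_derive_eq (is_deriveD (is_derive_cst (1 : R) s 1) (is_derive_id s 1)) _).
by rewrite add0r.
Qed.

Lemma is_derive_rad_a s : 0 <= s -> is_derive s 1 rad_a (- rad_a s ^+ 2).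
Proof.
move=> s0; have n0 : 1 + s != 0 by rewrite gt_eqF// ltr_pwDl.
refine (is_derive_eq (@is_deriveV _ (fun t => 1 + t) s 1 1 n0 (is_derive_1D s)) _).
by rewrite /GRing.scale /= mulr1 /rad_a exprVn.
Qed.

Lemma is_derive_ln1 s : 0 <= s -> is_derive s 1 (fun t : R => ln (1 + t)) (rad_a s).
Proof.
move=> s0; have p0 : 0 < 1 + s by rewrite ltr_pwDl.
refine (is_derive_eq (is_derive1_comp (is_derive1_ln p0) (is_derive_1D s)) _).
by rewrite mulr1.
Qed.

Lemma is_derive_1ln1 s : 0 <= s -> is_derive s 1 (fun t : R => 1 + ln (1 + t)) (rad_a s).
Proof.
move=> s0.
refine (is_derive_eq (is_deriveD (is_derive_cst (1 : R) s 1) (is_derive_ln1 s0)) _).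
by rewrite add0r.
Qed.

Lemma is_derive_rad_b s : 0 <= s ->
  is_derive s 1 rad_b (- (rad_b s ^+ 2 * rad_a s)).
Proof.
move=> s0; have n0 : 1 + ln (1 + s) != 0 by rewrite gt_eqF// ltr_pwDl// ln1_ge0.
refine (is_derive_eq (@is_deriveV _ (fun t => 1 + ln (1 + t)) s _ 1 n0 (is_derive_1ln1 s0)) _).
by rewrite /GRing.scale /= /rad_b exprVn mulNr.
Qed.

Lemma is_derive_rad_m s : 0 <= s -> is_derive s 1 rad_m (rad_a s * rad_b s).
Proof.
move=> s0; have p0 : 0 < 1 + ln (1 + s) by rewrite ltr_pwDl// ln1_ge0.
refine (is_derive_eq (@is_derive1_comp R (@ln R) (fun t => 1 + ln (1 + t)) s _ _
  (is_derive1_ln p0) (is_derive_1ln1 s0)) _).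
by rewrite mulrC.
Qed.

Variable N : R.

Definition rad_y s : R := 2^-1 * (1 - rad_m s / N).

Lemma is_derive_rad_y s : 0 <= s ->
  is_derive s 1 rad_y (- (2 * N)^-1 * (rad_a s * rad_b s)).
Proof.
move=> s0.
have -> : rad_y = cst 2^-1 + (- (2 * N)^-1) *: rad_m.
  suff h t : rad_y t = 2^-1 + (- (2 * N)^-1) * rad_m t by apply/funext => t; exact: h.
  by rewrite /rad_y invfM; ring.
refine (is_derive_eq (is_deriveD (is_derive_cst (2^-1 : R) s 1)
  (is_deriveZ (- (2 * N)^-1) (is_derive_rad_m s0))) _).
by rewrite add0r.
Qed.

Definition rad_flat k s : R := flat k (rad_y s).

Lemma is_derive_rad_flat k s : 0 <= s -> is_derive s 1 (rad_flat k)
  ((rad_flat k.+2 s - k%:R * rad_flat k.+1 s) * (- (2 * N)^-1 * (rad_a s * rad_b s))).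
Proof.
move=> s0.
exact: (is_derive1_comp (is_derive_flat k (rad_y s)) (is_derive_rad_y s0)).
Qed.

(** An algebra stable under partial derivatives, so smoothness follows by induction on the list of
    derivatives. No logarithm is among the generators: differentiating [rad_flat], [rad_a] or
    [rad_b] produces only [rad_flat], [rad_a], [rad_b] and coordinates. *)
Inductive radial_algebra : (Rd -> R) -> Prop :=
| ra_cst c : radial_algebra (fun=> c)
| ra_coord j : radial_algebra (fun x => x 0 j)
| ra_a : radial_algebra (fun x => rad_a (dot x x))
| ra_b : radial_algebra (fun x => rad_b (dot x x))
| ra_flat k : radial_algebra (fun x => rad_flat k (dot x x))
| ra_add f g : radial_algebra f -> radial_algebra g -> radial_algebra (fun x => f x + g x)
| ra_mul f g : radial_algebra f -> radial_algebra g -> radial_algebra (fun x => f x * g x).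

Let has_grad_rad (h dh : R -> R) : (forall s, 0 <= s -> is_derive s 1 h (dh s)) ->
  has_grad (fun x => h (dot x x)) (fun i x => dh (dot x x) * (2 * x 0 i)).
Proof. by move=> hd; apply: (has_grad_comp has_grad_sq) => x; apply: hd; exact: dot_ge0. Qed.

Lemma radial_algebra_grad f : radial_algebra f ->
  exists2 df, has_grad f df & forall i, radial_algebra (df i).
Proof.
have r2 i : radial_algebra (fun x => 2 * x 0 i) by apply: ra_mul; [exact: ra_cst|exact: ra_coord].
have rN c h : radial_algebra h -> radial_algebra (fun x => c * h x).
  by move=> rh; apply: ra_mul => //; exact: ra_cst.
elim=> [c|j|||k|{}f g _ [df fdf rdf] rg [dg gdg rdg]|{}f g rf [df fdf rdf] rg [dg gdg rdg]].
- by exists (fun _ _ => 0); [exact: has_grad_cst|move=> i; exact: ra_cst].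
- by exists (fun i _ => (i == j)%:R); [exact: has_grad_coord|move=> i; exact: ra_cst].
- exists (fun i x => - 1 * (rad_a (dot x x) * rad_a (dot x x)) * (2 * x 0 i)).
    have := has_grad_rad is_derive_rad_a; rewrite (_ : (fun i x => _) =
      (fun i x => - 1 * (rad_a (dot x x) * rad_a (dot x x)) * (2 * x 0 i)))//.
    by apply/funext => i; apply/funext => x; rewrite mulN1r expr2.
  by move=> i; apply: ra_mul => //; apply: rN; apply: ra_mul; exact: ra_a.
- exists (fun i x => - 1 * ((rad_b (dot x x) * rad_b (dot x x)) * rad_a (dot x x)) * (2 * x 0 i)).
    have := has_grad_rad is_derive_rad_b; rewrite (_ : (fun i x => _) =
      (fun i x => - 1 * ((rad_b (dot x x) * rad_b (dot x x)) * rad_a (dot x x)) * (2 * x 0 i)))//.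
    by apply/funext => i; apply/funext => x; rewrite mulN1r expr2.
  move=> i; apply: ra_mul => //; apply: rN; apply: ra_mul; last exact: ra_a.
  by apply: ra_mul; exact: ra_b.
- exists (fun i x => (rad_flat k.+2 (dot x x) + - k%:R * rad_flat k.+1 (dot x x)) *
      (- (2 * N)^-1 * (rad_a (dot x x) * rad_b (dot x x))) * (2 * x 0 i)).
    have := has_grad_rad (is_derive_rad_flat k); rewrite (_ : (fun i x => _) =
      (fun i x => (rad_flat k.+2 (dot x x) + - k%:R * rad_flat k.+1 (dot x x)) *
      (- (2 * N)^-1 * (rad_a (dot x x) * rad_b (dot x x))) * (2 * x 0 i)))//.
    by apply/funext => i; apply/funext => x; rewrite mulNr.
  move=> i; apply: ra_mul => //; apply: ra_mul.
    by apply: ra_add; [exact: ra_flat|apply: rN; exact: ra_flat].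
  by apply: rN; apply: ra_mul; [exact: ra_a|exact: ra_b].
- exists (fun i x => df i x + dg i x); first exact: has_gradD.
  by move=> i; exact: ra_add.
- exists (fun i x => f x * dg i x + g x * df i x); first exact: has_gradM.
  by move=> i; apply: ra_add; exact: ra_mul.
Qed.

Lemma radial_algebra_smooth f : radial_algebra f -> smooth f.
Proof.
move=> rf s; suff rs : radial_algebra (foldr (@pd R d) f s).
  have [df [fd _] _] := radial_algebra_grad rs.
  by split=> [x|i x]; [exact: differentiable_continuous|exact: diff_derivable].
elim: s => //= i s IH; have [df [_ fE] rdf] := radial_algebra_grad IH.
by rewrite (_ : pd i _ = df i)//; apply/funext => x; exact: fE.
Qed.

Definition cutoff x : R := expR 2 * rad_flat 0 (dot x x).

Lemma cutoff_smooth : smooth cutoff.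
Proof.
by apply: radial_algebra_smooth; apply: ra_mul; [exact: ra_cst|exact: ra_flat].
Qed.

(** With [cutoff''], the derivatives of the profile in s. Writing a and b for [rad_a] and [rad_b],
    the derivative of [rad_y] is -ab / (2N), and that of ab is -a^2 b (1 + b). *)
Definition cutoff' s : R := - (expR 2 / (2 * N)) * (rad_flat 2 s * (rad_a s * rad_b s)).

Definition cutoff'' s : R :=
  expR 2 / (4 * N ^+ 2) * ((rad_flat 4 s - 2 * rad_flat 3 s) * (rad_a s * rad_b s) ^+ 2)
  + expR 2 / (2 * N) * (rad_flat 2 s * (rad_a s ^+ 2 * rad_b s * (1 + rad_b s))).

Lemma pd_cutoff i x : pd i cutoff x = cutoff' (dot x x) * (2 * x 0 i).
Proof.
have [_ h] := has_gradM (has_grad_cst (expR 2)) (has_grad_rad (is_derive_rad_flat 0)).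
rewrite [LHS]h mulr0 addr0 /cutoff' mul0r subr0 invfM; ring.
Qed.

Lemma pd2_cutoff i j x : 0 < N -> pd i (pd j cutoff) x =
  cutoff'' (dot x x) * (4 * (x 0 i * x 0 j)) + cutoff' (dot x x) * (2 * (i == j)%:R).
Proof.
move=> N0.
rewrite (_ : pd j cutoff = fun x => cutoff' (dot x x) * (2 * x 0 j)); last first.
  by apply/funext => y; exact: pd_cutoff.
have := has_gradM (has_gradM (has_grad_cst (- (expR 2 / (2 * N))))
  (has_gradM (has_grad_rad (is_derive_rad_flat 2))
  (has_gradM (has_grad_rad is_derive_rad_a) (has_grad_rad is_derive_rad_b))))
  (has_gradM (has_grad_cst 2) (has_grad_coord j)).
move=> [_ h]; rewrite [LHS]h /cutoff'' /cutoff'; field.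
by rewrite gt_eqF.
Qed.

Lemma diff_op_cutoff (A : Rd -> 'M[R]_d) (G : Rd -> Rd) x : 0 < N ->
  diff_op A G cutoff x =
  2 * cutoff'' (dot x x) * dot (mxapp (A x) x) x
  + cutoff' (dot x x) * (\tr (A x) + 2 * dot (G x) x).
Proof.
move=> N0; rewrite /diff_op.
have -> : \sum_i \sum_j A x i j * pd i (pd j cutoff) x =
    4 * cutoff'' (dot x x) * dot (mxapp (A x) x) x + 2 * cutoff' (dot x x) * \tr (A x).
  rewrite /mxtrace /dot !mulr_sumr -big_split /=; apply: eq_bigr => i _.
  rewrite /mxapp mxE mulr_suml mulr_sumr.
  rewrite (eq_bigr (fun j => 4 * cutoff'' (dot x x) * (x 0 j * (A x)^T j i * x 0 i) +
     2 * cutoff' (dot x x) * (A x i j * (i == j)%:R))); last first.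
    by move=> j _; rewrite pd2_cutoff// mxE; ring.
  rewrite big_split /=; congr (_ + _).
  rewrite -mulr_sumr (bigD1 i)//= eqxx mulr1 big1 ?addr0// => j ji.
  by rewrite eq_sym (negbTE ji) mulr0.
have -> : \sum_i G x 0 i * pd i cutoff x = cutoff' (dot x x) * (2 * dot (G x) x).
  rewrite /dot !mulr_sumr; apply: eq_bigr => i _; rewrite pd_cutoff; ring.
by field.
Qed.

End radial.

(** * Bounds and convexity of the radial profile *)

Section cutoff_estimates.
Context {R : realType} {d : nat}.
Local Notation Rd := 'rV[R]_d.
Variable N : R.
Hypothesis N0 : 0 < N.
Implicit Types (s : R) (x : Rd).

Lemma rad_y_le s : 0 <= s -> rad_y N s <= 2^-1.
Proof.
move=> s0; rewrite /rad_y; have : 0 <= rad_m s / N by rewrite divr_ge0 ?rad_m_ge0// ltW.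
lra.
Qed.

Lemma rad_a_le1 s : 0 <= s -> rad_a s <= 1.
Proof. by move=> s0; rewrite invf_le1 ?ltr_pwDl// lerDl. Qed.

Lemma rad_b_le1 s : 0 <= s -> rad_b s <= 1.
Proof. by move=> s0; rewrite invf_le1 ?ltr_pwDl ?ln1_ge0// lerDl ln1_ge0. Qed.

Lemma rad_flat_le k s : 0 <= s -> rad_flat N k s <= k.+1`!%:R.
Proof.
move=> s0; have ys := rad_y_le s0; rewrite /rad_flat.
have [y0|y0] := ltP 0 (rad_y N s); last by rewrite /flat ltNge y0.
apply: le_trans (flat_le k _) _; rewrite ler_piMr// gtr0_norm//; lra.
Qed.

Lemma flat0_le (y : R) : y <= 2^-1 -> expR 2 * flat 0 y <= 1.
Proof.
move=> y2; rewrite /flat; case: ifP => y0; last by rewrite mulr0.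
rewrite expr0 invr1 mul1r -expRD -[leRHS]expR0 ler_expR subr_le0.
by rewrite -[2]invrK lef_pV2 ?posrE ?invr_gt0.
Qed.

Lemma cutoff01 x : 0 <= cutoff N x <= 1.
Proof.
rewrite mulr_ge0 ?expR_ge0 ?flat_ge0//=; apply: flat0_le; apply: rad_y_le.
exact: dot_ge0.
Qed.

Let e2 : 0 < expR 2 :> R. Proof. exact: expR_gt0. Qed.

Let c4 : 0 <= expR 2 / (4 * N ^+ 2).
Proof. by apply: divr_ge0; [exact: ltW|rewrite mulr_ge0// exprn_ge0// ltW]. Qed.
Let c2 : 0 <= expR 2 / (2 * N).
Proof. by apply: divr_ge0; [exact: ltW|rewrite mulr_ge0// ltW]. Qed.

Lemma cutoff'_le0 s : 0 <= s -> cutoff' N s <= 0.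
Proof.
move=> s0; rewrite /cutoff' mulNr oppr_le0 mulr_ge0// mulr_ge0 ?flat_ge0//.
by apply: mulr_ge0; apply: ltW; [exact: rad_a_gt0|exact: rad_b_gt0].
Qed.

(** The expression is the second derivative of [flat 0] and factors as [(1 - 2 * y) * flat 4 y]. *)
Lemma flat_convex (y : R) : y <= 2^-1 -> 0 <= flat 4 y - 2 * flat 3 y.
Proof.
move=> y2; rewrite (flatS 3); have := flat_ge0 4 y; nra.
Qed.

Let cutoff''_ge s : 0 <= s ->
  expR 2 / (2 * N) * (rad_flat N 2 s * (rad_a s ^+ 2 * rad_b s * (1 + rad_b s))) <=
  cutoff'' N s.
Proof.
move=> s0; rewrite /cutoff'' lerDr mulr_ge0// mulr_ge0 ?sqr_ge0//.
by apply: flat_convex; exact: rad_y_le.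
Qed.

Lemma cutoff''_ge0 s : 0 <= s -> 0 <= cutoff'' N s.
Proof.
move=> s0; apply: le_trans (cutoff''_ge s0).
have a0 := ltW (rad_a_gt0 s0); have b0 := ltW (rad_b_gt0 s0).
apply: mulr_ge0 => //; apply: mulr_ge0; first exact: flat_ge0.
by apply: mulr_ge0; [rewrite mulr_ge0// exprn_ge0|rewrite addr_ge0].
Qed.

Lemma cutoff''_le s : 0 <= s ->
  cutoff'' N s <= expR 2 / (4 * N ^+ 2) * 5`!%:R + expR 2 / (2 * N) * (3`!%:R * 2).
Proof.
move=> s0; rewrite /cutoff''.
have a0 := ltW (rad_a_gt0 s0); have b0 := ltW (rad_b_gt0 s0).
have a1 := rad_a_le1 s0; have b1 := rad_b_le1 s0.
have ab1 : rad_a s * rad_b s <= 1 by rewrite mulr_ile1.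
have ab0 : 0 <= rad_a s * rad_b s by rewrite mulr_ge0.
have aab1 : rad_a s ^+ 2 * rad_b s <= 1 by rewrite mulr_ile1 ?exprn_ge0 ?exprn_ile1.
have aab0 : 0 <= rad_a s ^+ 2 * rad_b s by rewrite mulr_ge0 ?exprn_ge0.
apply: lerD; rewrite ler_wpM2l//.
  have h4 := rad_flat_le 4 s0; have h3 := flat_ge0 3 (rad_y N s).
  have h := flat_convex (rad_y_le s0).
  rewrite -[leRHS]mulr1 ler_pM ?exprn_ge0 ?exprn_ile1//.
  by apply: le_trans h4; rewrite gerBl mulr_ge0.
have h2 := rad_flat_le 2 s0.
rewrite ler_pM ?flat_ge0 ?mulr_ge0 ?addr_ge0//.
rewrite -[leRHS]mul1r ler_pM ?addr_ge0//; lra.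
Qed.

(** The origin of the threshold 4: exp (s - 1) >= 1 + (s - 1)^2 / 2 >= 1 + s, where the last
    inequality holds from s = 2 + sqrt 3 on. *)
Lemma ln1_le (s : R) : 4 <= s -> 1 + ln (1 + s) <= s.
Proof.
move=> s4; rewrite -lerBrDl -ler_expR lnK ?posrE; last by lra.
have t0 : 0 <= s - 1 by lra.
apply: le_trans (expR_ge1Dxn 1 t0).
rewrite (_ : 2`! = 2%N)// expr2; nra.
Qed.

(* The Lyapunov inequality: with s = |x|^2 and s >= 1 + ln (1 + s), the function
   s m'(s), where m = [rad_m], is nonincreasing at s. *)
Lemma cutoff_lyapunov (s : R) : 4 <= s -> 0 <= cutoff'' N s + cutoff' N s / s.
Proof.
move=> s4; have s0 : 0 <= s by lra.
have sp : 0 < s by lra.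
have := cutoff''_ge s0; set Z := cutoff'' N s.
rewrite /cutoff'; set c := expR 2 / (2 * N); set b2 := rad_flat N 2 s => hZ.
have b20 : 0 <= b2 by exact: flat_ge0.
have a0 := rad_a_gt0 s0; have b0 := rad_b_gt0 s0.
suff h : s^-1 <= rad_a s * (1 + rad_b s).
  apply: (@le_trans _ _ (c * b2 * (rad_a s * rad_b s) * (rad_a s * (1 + rad_b s) - s^-1))).
    apply: mulr_ge0; last by rewrite subr_ge0.
    by apply: mulr_ge0; [exact: mulr_ge0|apply: mulr_ge0; exact: ltW].
  move: hZ; rewrite /c/= => hZ; apply: le_trans (lerD hZ (lexx _)).
  by rewrite le_eqVlt; apply/orP; left; apply/eqP; ring.
rewrite -[s^-1]mul1r ler_pdivrMr//.
have sb : 1 <= rad_b s * s.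
  by rewrite /rad_b ler_pdivlMl ?mulr1 ?ltr_pwDl ?ln1_ge0//; exact: ln1_le.
have : rad_a s * (1 + s) = 1 by rewrite mulVf// gt_eqF// ltr_pwDl.
nra.
Qed.

End cutoff_estimates.

(** * Compact support and convergence of the cutoffs *)

Section cutoff_test_functions.
Context {R : realType} {d : nat}.
Local Notation Rd := 'rV[R]_d.
Implicit Types (x : Rd).

Lemma compact_closure_dot (V : set Rd) (C : R) :
  (forall x, V x -> dot x x <= C) -> compact (closure V).
Proof.
(* With M >= 1, a coordinate whose square is at most M is itself at most M in absolute value. *)
move=> VC; pose M := Num.max C 1.
pose box := [set x : Rd | forall i, `[- M, M]%classic (x ord0 i)].
have cbox : compact box.
  by apply: (@rV_compact R d (fun=> `[- M, M]%classic)) => i; exact: segment_compact.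
have clbox : closed box by apply: (compact_closed _ cbox); exact: norm_hausdorff.
apply: (@subclosed_compact _ (closure V) box) => //; first exact: closed_closure.
rewrite (closure_id box).1//; apply: closure_subset => x Vx i /=.
rewrite in_itv/= -ler_norml.
have M1 : 1 <= M by rewrite le_max lexx orbT.
have xiM : `|x ord0 i| ^+ 2 <= M.
  rewrite real_normK ?num_real//; apply: (@le_trans _ _ C); last by rewrite le_max lexx.
  apply: le_trans (VC x Vx); rewrite /dot (bigD1 i)//= -expr2 lerDl.
  by apply: sumr_ge0 => j _; rewrite -expr2 sqr_ge0.
rewrite leNgt; apply/negP => Ma; move: xiM; rewrite leNgt => /negP; apply.
rewrite expr2 (lt_le_trans Ma)// ler_peMr// ltW//; exact: le_lt_trans Ma.
Qed.

Lemma cutoff_test (N : R) : 0 < N -> test_fun setT (cutoff N : Rd -> R).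
Proof.
move=> N0; split=> //; first exact: cutoff_smooth.
(* Beyond s = exp (exp N) the double logarithm exceeds N, so [rad_y] is nonpositive and the profile
   vanishes. *)
apply: (@compact_closure_dot _ (expR (expR N))) => x /=.
apply: contraNT; rewrite -ltNge => sC.
have s0 := dot_ge0 x; rewrite /cutoff /rad_flat /flat ltNge.
suff -> : rad_y N (dot x x) <= 0 by rewrite mulr0.
have h1 : expR N <= ln (1 + dot x x).
  rewrite -ler_expR lnK ?posrE ?ltr_pwDl//.
  by apply: (le_trans (ltW sC)); rewrite lerDr.
have h2 : N <= rad_m (dot x x).
  rewrite /rad_m -ler_expR lnK ?posrE ?ltr_pwDl ?ln1_ge0//.
  by apply: (le_trans h1); rewrite lerDr.
have h3 : 1 <= rad_m (dot x x) / N by rewrite ler_pdivlMr// mul1r.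
rewrite /rad_y; lra.
Qed.

Lemma cutoff_cvg1 x : cutoff n.+1%:R x @[n --> \oo] --> (1 : R).
Proof.
have cy : rad_y n.+1%:R (dot x x) @[n --> \oo] --> (2^-1 : R).
  rewrite /rad_y [X in _ --> X](_ : 2^-1 = 2^-1 * (1 - rad_m (dot x x) * 0)); last first.
    by rewrite mulr0 subr0 mulr1.
  apply: cvgM; first exact: cvg_cst.
  apply: cvgB; first exact: cvg_cst.
  by apply: cvgM; [exact: cvg_cst|exact: cvg_harmonic].
have cflat : {for 2^-1, continuous (flat 0 : R -> R)}.
  apply: differentiable_continuous; apply/derivable1_diffP.
  by have [] := is_derive_flat 0 (2^-1 : R).
rewrite [X in _ --> X](_ : 1 = expR 2 * flat 0 2^-1); last first.
  by rewrite /flat invr_gt0 ltr0n invrK expr0 invr1 mul1r expRN divff// gt_eqF// expR_gt0.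
apply: cvgM; first exact: cvg_cst.
exact: (cvg_comp _ _ cy cflat).
Qed.

Lemma bounded_cutoff (N : R) : 0 < N -> bounded_mfun (cutoff N : Rd -> R).
Proof.
move=> N0; split.
  by apply: continuous_measurable_rV; have [] := @cutoff_smooth R d N [::].
by exists 1 => x; have /andP[? ?] := cutoff01 N0 x; rewrite ger0_norm.
Qed.

End cutoff_test_functions.

(** * Null sets and open sets for the invariant measure *)

Section density.
Context {R : realType} {d : nat}.
Local Notation Rd := 'rV[R]_d.
Variables (rho : Rd -> R) (mu : {measure set Rd -> \bar R}).
Hypotheses (rho_cont : continuous rho) (rho_gt0 : forall x, 0 < rho x).
Hypothesis mu_density : forall U, measurable U ->
  mu U = (\int[lebesgue_rV R d]_(x in U) (rho x)%:E)%E.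

Let mrho (D : set Rd) : measurable_fun D (fun x => (rho x)%:E).
Proof.
by apply: measurable_funTS; apply/measurable_EFinP; exact: continuous_measurable_rV.
Qed.

Lemma ae_lebesgue_density (Q : Rd -> Prop) :
  (\forall x \ae lebesgue_rV R d, Q x) -> \forall x \ae mu, Q x.
Proof.
move=> [N [mN N0 QN]]; exists N; split=> //; rewrite mu_density//.
rewrite -(integral_abs_eq0 mN (@mrho N) N0); apply: eq_integral => x _ /=.
by rewrite gtr0_norm.
Qed.

(** Near x the density exceeds [rho x / 2], and a sup norm ball contains a box of known positive
    volume. *)
Lemma density_open (U : set Rd) : open U -> U !=set0 -> mu U != 0%E.
Proof.
move=> oU [x Ux].
pose V := U `&` [set y | rho x / 2 < rho y].
have oV : open V.
  apply: openI => //.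
  have -> : [set y | rho x / 2 < rho y] = rho @^-1` [set t | rho x / 2 < t] by [].
  by apply: open_comp => [y _|]; [exact: rho_cont|exact: open_gt].
have Vx : V x by split=> //=; have := rho_gt0 x; lra.
have /nbhs_ballP[e /= e0 eV] : nbhs x V by exact: open_nbhs_nbhs.
pose a : Rd := \row_i (x 0 i - e / 2); pose b : Rd := \row_i (x 0 i + e / 2).
pose box := [set y : Rd | forall i, a 0 i <= y 0 i <= b 0 i].
have mbox : measurable box.
  rewrite (_ : box = \bigcap_(i in [set: 'I_d])
      ((fun y : Rd => y 0 i) @^-1` `[a 0 i, b 0 i])); last first.
    apply/seteqP; split=> [y h i _|y h i]; first by rewrite /= in_itv; exact: h.
    by have := h i Logic.I; rewrite /= in_itv.
  apply: fin_bigcap_measurable => // i _; rewrite -[X in measurable X]setTI.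
  exact: measurable_rV_coord.
have boxV : box `<=` V.
  move=> y hy; apply: eV; split=> // i j; rewrite (ord1 i) /ball /=.
  have := hy j; rewrite !mxE ltr_distlC => /andP[h1 h2]; apply/andP; split; lra.
have vol : (lebesgue_rV R d box = (\prod_(i < d) e)%:E)%E.
  rewrite lebesgue_rV_box; last by move=> i; rewrite !mxE; lra.
  by congr EFin; apply: eq_bigr => i _; rewrite !mxE; field.
have : (0 < (rho x / 2)%:E * lebesgue_rV R d box)%E.
  rewrite vol -EFinM lte_fin mulr_gt0//; first by rewrite divr_gt0.
  exact: prodr_gt0.
have mU := open_measurable_rV oU.
suff h : ((rho x / 2)%:E * lebesgue_rV R d box <= mu U)%E.
  by move=> /lt_le_trans /(_ h) /gt_eqF ->.
rewrite mu_density// -integral_cst//.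
apply: (@le_trans _ _ (\int[lebesgue_rV R d]_(y in box) (rho y)%:E)%E).
  apply: ge0_le_integral => //.
  - by move=> y _; rewrite lee_fin divr_ge0// ltW.
  - by move=> y /boxV[_ /= /ltW]; rewrite lee_fin.
apply: ge0_subset_integral => //.
- by move=> y _; rewrite lee_fin ltW.
- by move=> y /boxV[].
Qed.

End density.

(** * The Lyapunov condition *)

Section lyapunov.
Context {R : realType} {d : nat}.
Local Notation Rd := 'rV[R]_d.
Variables (A : Rd -> 'M[R]_d) (G : Rd -> Rd).
Hypothesis elliptic : forall V : set Rd, compact (closure V) ->
  exists2 nu : R, 0 < nu & forall x xi, V x ->
    nu^-1 * enorm xi ^+ 2 <= dot (mxapp (A x) xi) xi <= nu * enorm xi ^+ 2.
Implicit Types (x : Rd).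

Local Notation q x := (dot (mxapp (A x) x) x).
Local Notation K x := (\tr (A x) + 2 * dot (G x) x).

Lemma enorm_sq x : enorm x ^+ 2 = dot x x.
Proof. by rewrite /enorm sqr_sqrtr// dot_ge0. Qed.

Lemma quadratic_bounded (s : R) : exists2 nu : R, 0 < nu &
  forall x, dot x x <= s -> 0 <= q x <= nu.
Proof.
have [nu nu0 h] := elliptic
  (@compact_closure_dot R d [set x | dot x x <= s] s (fun x => id)).
exists (nu * `|s| + 1); first by rewrite ltr_wpDl// mulr_ge0// ltW.
move=> x xs; have := h x x xs; rewrite enorm_sq => /andP[h1 h2].
have s0 := dot_ge0 x; apply/andP; split.
  by apply: le_trans h1; rewrite mulr_ge0// invr_ge0 ltW.
apply: (le_trans h2); apply: (@le_trans _ _ (nu * `|s|)); last by rewrite lerDl.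
by rewrite ler_pM2l//; apply: (le_trans xs); exact: ler_norm.
Qed.

Lemma quadratic_ge0 x : 0 <= q x.
Proof. by have [nu _ /(_ x (lexx _)) /andP[]] := quadratic_bounded (dot x x). Qed.

(** The condition reads [K x <= 2 * (q x / s)]. Multiplied by the nonpositive [cutoff'], it bounds L
    chi_N below by [2 * q x] times the quantity of [cutoff_lyapunov]. *)
Lemma diff_op_cutoff_outside (N : R) x : 0 < N -> 4 <= dot x x ->
  - (q x / enorm x ^+ 2) + 2^-1 * \tr (A x) + dot (G x) x <= 0 ->
  0 <= diff_op A G (cutoff N) x.
Proof.
move=> N0 s4; rewrite enorm_sq diff_op_cutoff//; set s := dot x x => hK.
have s0 : 0 <= s by exact: dot_ge0.
have hl := cutoff_lyapunov N0 s4; have c1 := cutoff'_le0 N0 s0.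
have q0 := quadratic_ge0 x.
have hK2 : K x <= 2 * (q x / s) by lra.
have : cutoff' N s * K x >= cutoff' N s * (2 * (q x / s)) by rewrite ler_wnM2l.
have : 0 <= 2 * q x * (cutoff'' N s + cutoff' N s / s) by rewrite !mulr_ge0.
rewrite (_ : 2 * q x * (cutoff'' N s + cutoff' N s / s) =
  2 * cutoff'' N s * q x + cutoff' N s * (2 * (q x / s))); last by ring.
lra.
Qed.

(** The second-order part is nonnegative everywhere by convexity of the profile. What is left
    carries the factor 1/N that makes the negative part disappear in the limit. *)
Lemma diff_op_cutoff_ge (N : R) x : 0 < N ->
  - diff_op A G (cutoff N) x <= expR 2 / (2 * N) * (3`!%:R * Num.max (K x) 0).
Proof.
move=> N0; rewrite diff_op_cutoff//; set s := dot x x.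
have s0 : 0 <= s by exact: dot_ge0.
have c2 := cutoff''_ge0 N0 s0; have q0 := quadratic_ge0 x.
have h1 : 0 <= 2 * cutoff'' N s * q x by rewrite !mulr_ge0.
have c0 : 0 <= expR 2 / (2 * N) by rewrite divr_ge0 ?expR_ge0// mulr_ge0// ltW.
have a0 := ltW (rad_a_gt0 s0); have b0 := ltW (rad_b_gt0 s0).
have f0 : 0 <= rad_flat N 2 s * (rad_a s * rad_b s) by rewrite !mulr_ge0// flat_ge0.
have f1 : rad_flat N 2 s * (rad_a s * rad_b s) <= 3`!%:R.
  rewrite -[leRHS]mulr1; apply: ler_pM; [exact: flat_ge0|exact: mulr_ge0|exact: rad_flat_le|].
  by apply: mulr_ile1 => //; [exact: rad_a_le1|exact: rad_b_le1].
have : - (cutoff' N s * K x) <= expR 2 / (2 * N) * (3`!%:R * Num.max (K x) 0).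
  rewrite /cutoff' -!mulNr opprK -mulrA ler_wpM2l//.
  have m0 : 0 <= Num.max (K x) 0 by rewrite le_max lexx orbT.
  apply: (@le_trans _ _ (rad_flat N 2 s * (rad_a s * rad_b s) * Num.max (K x) 0)).
    by rewrite ler_wpM2l// le_max lexx.
  by rewrite ler_wpM2r.
lra.
Qed.

(** Solving the formula for L chi_N for [K], with one fixed N whose profile is strictly decreasing
    on the ball, gives a majorant of [K^+] there that is integrable for [mu]. *)
Lemma drift_bound_inside (s : R) : exists N M c : R, [/\ 0 < N, 0 <= M, 0 < c &
  forall x, dot x x <= s ->
    Num.max (K x) 0 <= c * (`|diff_op A G (cutoff N) x| + M * cutoff N x)].
Proof.
have [nu nu0 hq] := quadratic_bounded s.
pose t := `|s|; have t0 : 0 <= t by exact: normr_ge0.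
(* This choice gives [rad_y >= 1/4] on the ball; as also [rad_y <= 1/2], every [rad_flat N k] is at
   least exp (-4) there. *)
pose N := 2 * rad_m t + 1.
have N0 : 0 < N by rewrite ltr_wpDl// mulr_ge0// rad_m_ge0.
pose C := expR 2 / (4 * N ^+ 2) * 5`!%:R + expR 2 / (2 * N) * (3`!%:R * 2).
pose e := expR (- 4) : R.
have e0 : 0 < e by exact: expR_gt0.
(* A lower bound for [- cutoff'] on the ball; [(1 + t)^-1] bounds both [rad_a] and [rad_b] from
   below, since ln (1 + s) <= s. *)
pose l := expR 2 / (2 * N) * (e * ((1 + t)^-1 * (1 + t)^-1)).
have c0 : 0 < expR 2 / (2 * N) by rewrite divr_gt0 ?expR_gt0// mulr_gt0.
have ti : 0 < (1 + t)^-1 by rewrite invr_gt0 ltr_pwDl.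
have l0 : 0 < l by rewrite mulr_gt0// mulr_gt0// mulr_gt0.
have C0 : 0 <= C.
  apply: addr_ge0; last by apply: mulr_ge0; [exact: ltW|rewrite mulr_ge0].
  apply: mulr_ge0; last exact: ler0n.
  by apply: divr_ge0; [exact: expR_ge0|rewrite mulr_ge0// exprn_ge0// ltW].
(* The second-order term, at most 2 C nu, is majorized by a multiple of chi_N, which is integrable
   and at least e^2 exp (-4) on the ball. *)
pose M := 2 * C * nu * (expR 2 * e)^-1.
have ee0 : 0 < expR 2 * e by rewrite mulr_gt0// expR_gt0.
have Cnu0 : 0 <= 2 * C * nu by rewrite mulr_ge0// ?mulr_ge0// ltW.
have M0 : 0 <= M by rewrite mulr_ge0// invr_ge0 ltW.
exists N, M, l^-1; split=> //.
  by rewrite invr_gt0.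
move=> x xs; have s0 := dot_ge0 x; have /andP[q0 q1] := hq x xs.
have xt : dot x x <= t by apply: (le_trans xs); exact: ler_norm.
have yge : 4^-1 <= rad_y N (dot x x).
  have mm : rad_m (dot x x) <= rad_m t.
    rewrite /rad_m ler_ln ?posrE ?ltr_pwDl ?ln1_ge0//.
    by rewrite lerD2l ler_ln ?posrE ?ltr_pwDl// lerD2l.
  have : rad_m (dot x x) / N <= 2^-1 by rewrite ler_pdivrMr// /N; lra.
  by rewrite /rad_y; lra.
have y0 : 0 < rad_y N (dot x x) by apply: lt_le_trans yge; rewrite invr_gt0.
have y1 := rad_y_le N0 s0.
have eflat k : e <= rad_flat N k (dot x x).
  rewrite /rad_flat /flat y0 -[leLHS]mul1r ler_pM ?expR_ge0//.
    by rewrite invf_ge1 ?exprn_gt0// exprn_ile1// ?ltW//; lra.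
  by rewrite /e ler_expR lerN2 invf_ple ?posrE.
have ax : (1 + t)^-1 <= rad_a (dot x x).
  by rewrite /rad_a lef_pV2 ?posrE ?ltr_pwDl// lerD2l.
have bx : (1 + t)^-1 <= rad_b (dot x x).
  rewrite /rad_b lef_pV2 ?posrE ?ltr_pwDl ?ln1_ge0// lerD2l.
  by apply: le_trans xt; apply: le_ln1Dx; lra.
have lc : l <= - cutoff' N (dot x x).
  rewrite /cutoff' mulNr opprK ler_pM2l//.
  apply: ler_pM; [exact: ltW|by rewrite ltW// mulr_gt0|exact: eflat|].
  by apply: ler_pM => //; exact: ltW.
have chi_ge : expR 2 * e <= cutoff N x by rewrite /cutoff ler_pM2l ?expR_gt0//; exact: eflat.
have C2 : cutoff'' N (dot x x) <= C by exact: cutoff''_le.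
have C20 := cutoff''_ge0 N0 s0.
set L := diff_op A G (cutoff N) x.
have Kx : - cutoff' N (dot x x) * K x = 2 * cutoff'' N (dot x x) * q x - L.
  by rewrite /L diff_op_cutoff//; ring.
have Mx : 2 * C * nu <= M * cutoff N x.
  rewrite /M -(mulrA (2 * C * nu)) ler_peMr//.
  by rewrite mulrC ler_pdivlMr// mul1r.
have Cq : 2 * cutoff'' N (dot x x) * q x <= 2 * C * nu.
  by rewrite ler_pM// ?mulr_ge0// ler_pM2l.
have NL : - L <= `|L| by rewrite -normrN ler_norm.
have rhs0 : 0 <= `|L| + M * cutoff N x.
  by rewrite addr_ge0//; exact: le_trans Mx.
rewrite ge_max; apply/andP; split; last by rewrite mulr_ge0// invr_ge0 ltW.
rewrite ler_pdivlMl//; have [K0|K0] := leP (K x) 0.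
  by apply: le_trans rhs0; rewrite pmulr_rle0.
apply: (@le_trans _ _ (- cutoff' N (dot x x) * K x)); first by rewrite ler_pM2r.
rewrite Kx; lra.
Qed.

End lyapunov.

(** * The plateau sequence of the diffusion and recurrence *)

Section recurrence.
Context {R : realType} {d : nat}.
Local Notation Rd := 'rV[R]_d.
Variables (p : R) (A C : Rd -> 'M[R]_d) (H : Rd -> Rd) (rho : Rd -> R).
Variable mu : {measure set Rd -> \bar R}.
Variables T P : R -> (Rd -> R) -> Rd -> R.
Context {dO : measure_display} {Omega : measurableType dO}.
Variables (Ft : R -> set (set Omega)).
Variable X : R -> Omega -> one_point_compactification 'rV[R]_d.
Variable Px : one_point_compactification 'rV[R]_d -> probability Omega R.
Hypothesis ds : diffusion_setting p A C H rho mu T P Ft X Px.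
Variable N0 : nat.
Hypothesis lyap : \forall x \ae lebesgue_rV R d, N0%:R < enorm x ->
  - (dot (mxapp (A x) x) x / enorm x ^+ 2) + 2^-1 * \tr (A x)
  + dot (drift A C H x) x <= 0.

Let G := drift A C H.
Let chi (n : nat) : Rd -> R := cutoff n.+1%:R.
Let n0 n : 0 < n.+1%:R :> R. Proof. exact: ltr0Sn. Qed.

Let chi_gen N : 0 < N -> sg_generator mu T (cutoff N) (diff_op A G (cutoff N)).
Proof. by move=> NN; apply: (T_extends (ds_semigroup ds)); exact: cutoff_test. Qed.

Let pos_mass_diff_op_cvg :
  pos_mass mu (fun x => (- diff_op A G (chi n) x)%R) @[n --> \oo] --> 0%E.
Proof.
have ell := A_elliptic (ds_a ds).
have [_ _ rho0 mud _] := ds_density ds.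
have rhoc := rho_cont (ds_density ds).
(* Beyond s both requirements hold: |x| > N0 for the condition and |x|^2 >= 4 for
   [cutoff_lyapunov]. *)
pose s : R := N0%:R ^+ 2 + 4.
have [N [M [c [NN M0 c0 hK]]]] := drift_bound_inside G ell s.
pose h x := `|diff_op A G (cutoff N) x| + M * cutoff N x.
have h0 x : 0 <= h x.
  by rewrite addr_ge0// mulr_ge0//; have /andP[] := cutoff01 NN x.
have [chiL LL _] := chi_gen NN.
have hL : h \in Lfun mu 1%E.
  have := Lfun1_linear M chiL (Lfun_norm LL).
  by rewrite (_ : _ \+ _ = h)//; apply/funext => x; rewrite /h /= addrC.
have [mh hfin] := (Lfun1P mu h).1 hL.
pose C0 := expR 2 * (3`!%:R * c).
have le_n n : (pos_mass mu (fun x => (- diff_op A G (chi n) x)%R) <=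
    (C0 * n.+1%:R^-1)%:E * \int[mu]_x `|h x|%:E)%E.
  have C00 : 0 <= C0 * n.+1%:R^-1.
    by rewrite mulr_ge0 ?invr_ge0// mulr_ge0 ?expR_ge0// mulr_ge0// ltW.
  have [_ Ln _] := chi_gen (n0 n).
  have [mL _] := (Lfun1P mu _).1 Ln.
  rewrite -ge0_integralZl_EFin//; last 1 first.
  - by apply/measurable_EFinP; exact: measurableT_comp.
  rewrite /pos_mass; apply: ae_ge0_le_integral => //.
  - by move=> x _; rewrite lee_fin le_max lexx orbT.
  - by apply/measurable_EFinP; apply: measurable_maxr => //; exact: measurableT_comp.
  - by move=> x _; rewrite -EFinM lee_fin mulr_ge0.
  - apply/measurable_EFinP; apply: measurable_funM => //; exact: measurableT_comp.
  have lm := ae_lebesgue_density rhoc rho0 mud lyap.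
  apply: filterS lm => x lx _; rewrite -EFinM lee_fin ger0_norm//.
  rewrite ge_max mulr_ge0 ?andbT//.
  have [xs|xs] := leP (dot x x) s.
    apply: (le_trans (diff_op_cutoff_ge G ell x (n0 n))).
    have := hK x xs; rewrite -/(h x) => hKx.
    apply: (@le_trans _ _ (expR 2 / (2 * n.+1%:R) * (3`!%:R * (c * h x)))).
      rewrite ler_wpM2l// ?divr_ge0 ?expR_ge0 ?mulr_ge0//.
      by rewrite ler_wpM2l.
    rewrite /C0 invfM.
    have e0 : 0 < expR 2 :> R by exact: expR_gt0.
    have ch : 0 <= expR 2 * n.+1%:R^-1 * (3`!%:R * (c * h x)).
      apply: mulr_ge0; first by apply: mulr_ge0; [exact: ltW|rewrite invr_ge0].
      by apply: mulr_ge0 => //; apply: mulr_ge0 => //; exact: ltW.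
    set u := n.+1%:R^-1 in ch *; set f3 := 3`!%:R in ch *; set e := expR 2 in ch *.
    rewrite (_ : e * (f3 * c) * u * h x = e * u * (f3 * (c * h x))); last by ring.
    rewrite (_ : e * (2^-1 * u) * (f3 * (c * h x)) =
      2^-1 * (e * u * (f3 * (c * h x)))); last by ring.
    lra.
  apply: (@le_trans _ _ 0); last by rewrite mulr_ge0.
  rewrite oppr_le0; apply: diff_op_cutoff_outside => //.
    by apply/ltW/(le_lt_trans _ xs); rewrite /s lerDr sqr_ge0.
  apply: lx; rewrite /enorm -[ltLHS]ger0_norm// -sqrtr_sqr ltr_sqrt.
    by apply: le_lt_trans xs; rewrite /s lerDl.
  by apply: le_lt_trans xs; rewrite addr_ge0// sqr_ge0.
have cv : ((C0 * n.+1%:R^-1)%:E * \int[mu]_x `|h x|%:E)%E @[n --> \oo] --> 0%E.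
  have fh : (\int[mu]_x `|h x|%:E)%E \is a fin_num.
    by rewrite ge0_fin_numE// integral_ge0.
  rewrite -(fineK fh); under eq_fun do rewrite -EFinM.
  apply: cvg_EFin; first by near=> n.
  rewrite [X in _ --> X](_ : 0 = C0 * 0 * fine (\int[mu]_x `|h x|%:E)); last first.
    by rewrite mulr0 mul0r.
  apply: cvgM; last exact: cvg_cst.
  by apply: cvgM; [exact: cvg_cst|exact: cvg_harmonic].
apply: (squeeze_cvge _ (cvg_cst 0%E) cv).
by near=> n; rewrite pos_mass_ge0 le_n.
Unshelve. all: by end_near. Qed.

Let hunt := ds_hunt ds.
Let trans := ds_transition ds.
Let semiT := T_sub_markovian_C0 (ds_semigroup ds).
Let verP := ds_version ds.

Lemma cutoff_plateau : plateau mu (P 1) chi.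
Proof.
have chib n : bounded_mfun (chi n) by exact: bounded_cutoff.
have chi01 n x : 0 <= chi n x <= 1 by exact: cutoff01.
split=> //.
- exact: cutoff_cvg1.
- move=> n; have [chiL _ _] := chi_gen (n0 n).
  have [_] := (Lfun1P mu _).1 chiL; apply: le_lt_trans.
  rewrite le_eqVlt; apply/orP; left; apply/eqP; apply: eq_integral => x _.
  by rewrite ger0_norm//; have /andP[] := chi01 n x.
- apply: (squeeze_cvge _ (cvg_cst 0%E) pos_mass_diff_op_cvg).
  near=> n; apply/andP; split; first exact: pos_mass_ge0.
  exact: (pos_mass_generator hunt trans semiT verP (chib n) (chi_gen (n0 n))).
Unshelve. all: by end_near. Qed.

Lemma recurrent_of_lyapunov : recurrent X Px.
Proof.
have [_ _ rho0 mud _] := ds_density ds.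
have rhoc := rho_cont (ds_density ds).
have muo := density_open rhoc rho0 mud.
have HP := P_sub_markov hunt trans semiT verP ltr01.
have feller f : bounded_mfun f -> continuous (P 1 f) by exact: (P_feller verP).
have pl := cutoff_plateau.
move=> x U oU U0; apply: (last_exit_infinite_as hunt trans oU HP).
- exact: (conservative muo HP feller pl).
- exact: (avoid_cvg0 muo HP feller pl oU U0).
Qed.

End recurrence.

(** * The planar case *)

Section rotated_diagonal.
Context {R : realType}.

Lemma dotE n (u v : 'rV[R]_n) : dot u v = (u *m v^T) 0 0.
Proof. by rewrite mxE; apply: eq_bigr => i _; rewrite mxE. Qed.

(** For y = Qx (vectors are rows, so [x *m Q^T]), of the same length as x, the quotient is a
    weighted mean of a and b. It is therefore at least their minimum (a + b) / 2 - |a - b| / 2, and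
    the trace is a + b. *)
Lemma rotated_diagonal_bound (M Q : 'M[R]_2) (a b : R) (x : 'rV[R]_2) :
  Q^T *m Q = 1%:M -> M = Q^T *m diag_mx (\row_(i < 2) (if i == 0 then a else b)) *m Q ->
  0 < enorm x ->
  - (dot (mxapp M x) x / enorm x ^+ 2) + 2^-1 * \tr M <= `|a - b| / 2.
Proof.
move=> QQ ->; set D := diag_mx _ => x0.
have trE : \tr (Q^T *m D *m Q) = a + b.
  rewrite mxtrace_mulC mulmxA (mulmx1C QQ) mul1mx /mxtrace !big_ord_recl big_ord0.
  by rewrite !mxE /= addr0.
pose y := x *m Q^T.
have yy : dot y y = enorm x ^+ 2.
  by rewrite enorm_sq !dotE trmx_mul trmxK mulmxA -(mulmxA x) QQ mulmx1.
have qE : dot (mxapp (Q^T *m D *m Q) x) x = a * y 0 0 ^+ 2 + b * y 0 1 ^+ 2.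
  transitivity (dot (y *m D) y).
    rewrite !dotE /mxapp !trmx_mul !trmxK tr_diag_mx /y.
    by rewrite !mulmxA.
  rewrite /dot mul_mx_diag !big_ord_recl big_ord0 !mxE /= addr0.
  rewrite (_ : lift ord0 ord0 = 1); last exact: val_inj.
  ring.
have yyE : enorm x ^+ 2 = y 0 0 ^+ 2 + y 0 1 ^+ 2.
  rewrite -yy /dot !big_ord_recl big_ord0 addr0 !expr2.
  by rewrite (_ : lift ord0 ord0 = 1)//; exact: val_inj.
have e0 : 0 < enorm x ^+ 2 by rewrite exprn_gt0.
have mab : (a + b) / 2 - `|a - b| / 2 <= dot (mxapp (Q^T *m D *m Q) x) x / enorm x ^+ 2.
  rewrite ler_pdivlMr// qE yyE.
  have u0 : 0 <= y 0 0 ^+ 2 by exact: sqr_ge0.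
  have v0 : 0 <= y 0 1 ^+ 2 by exact: sqr_ge0.
  by case: (ltrgt0P (a - b)) => ab; nra.
rewrite trE; lra.
Qed.

End rotated_diagonal.

Theorem corollary3p41 (R : realType) :
  (forall (d : nat) (p : R) (A C : 'rV[R]_d -> 'M[R]_d)
      (H : 'rV[R]_d -> 'rV[R]_d) (rho : 'rV[R]_d -> R)
      (mu : {measure set 'rV[R]_d -> \bar R})
      (T P : R -> ('rV[R]_d -> R) -> 'rV[R]_d -> R)
      (dO : measure_display) (Omega : measurableType dO)
      (Ft : R -> set (set Omega))
      (X : R -> Omega -> one_point_compactification 'rV[R]_d)
      (Px : one_point_compactification 'rV[R]_d -> probability Omega R),
    diffusion_setting p A C H rho mu T P Ft X Px ->
    (exists N0 : nat, \forall x \ae lebesgue_rV R d, N0%:R < enorm x ->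
       - (dot (mxapp (A x) x) x / enorm x ^+ 2) + 2^-1 * \tr (A x)
         + dot (drift A C H x) x <= 0) ->
    recurrent X Px) /\
  (forall (p : R) (A C : 'rV[R]_2 -> 'M[R]_2)
      (H : 'rV[R]_2 -> 'rV[R]_2) (rho : 'rV[R]_2 -> R)
      (mu : {measure set 'rV[R]_2 -> \bar R})
      (T P : R -> ('rV[R]_2 -> R) -> 'rV[R]_2 -> R)
      (dO : measure_display) (Omega : measurableType dO)
      (Ft : R -> set (set Omega))
      (X : R -> Omega -> one_point_compactification 'rV[R]_2)
      (Px : one_point_compactification 'rV[R]_2 -> probability Omega R)
      (N0 : nat) (Psi1 Psi2 : 'rV[R]_2 -> R) (Q : 'rV[R]_2 -> 'M[R]_2),
    diffusion_setting p A C H rho mu T P Ft X Px ->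
    continuous Psi1 -> continuous Psi2 ->
    (forall x, 0 < Psi1 x /\ 0 < Psi2 x) ->
    (forall i j, measurable_fun setT (fun x => Q x i j)) ->
    (forall x, N0%:R < enorm x -> (Q x)^T *m Q x = 1%:M) ->
    (forall x, N0%:R < enorm x ->
       A x = (Q x)^T *m
             diag_mx (\row_(i < 2) (if i == 0 then Psi1 x else Psi2 x)) *m Q x) ->
    (\forall x \ae lebesgue_rV R 2, N0%:R < enorm x ->
       `|Psi1 x - Psi2 x| / 2 + dot (drift A C H x) x <= 0) ->
    recurrent X Px).
Proof.
split=> [d p A C H rho mu T P dO Omega Ft X Px ds [N0 lyap]|].
  exact: (recurrent_of_lyapunov ds lyap).
move=> p A C H rho mu T P dO Omega Ft X Px N0 Psi1 Psi2 Q ds _ _ _ _ QQ AE hG.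
apply: (@recurrent_of_lyapunov _ _ _ _ _ _ _ _ _ _ _ _ _ _ _ ds N0).
apply: filterS hG => x hx N0x.
have x0 : 0 < enorm x by apply: le_lt_trans N0x; exact: ler0n.
have := rotated_diagonal_bound (QQ x N0x) (AE x N0x) x0; have := hx N0x; lra.
Qed.
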